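(* Let $X$ be a one-dimensional Lévy process with Lévy measure $\Pi$ and Laplace exponent $\psi$, such that $k=\inf\{x>0:\Pi((x,\infty))=0\}$ satisfies $0<k<\infty$, and let $q>0$. Let $\{\zeta_n\}_{n\ge1}$ be the solutions of $\psi(z)=q$ in $\mathcal Q_1=\{z\in\mathbb C:\operatorname{Re}(z)>0,\ \operatorname{Im}(z)>0\}$ (repeated according to multiplicity), arranged in order of increasing absolute value. Assume that there are constants $A,B\in\mathbb C\setminus\{0\}$, $a\ge 0$ and $b>0$ such that $$\psi(z)=Ae^{kz}z^{-a}+Bz^b+o\left(e^{kz}z^{-a}\right)+o\left(z^b\right)$$ as $z\to\infty$ in the domain $\mathcal Q_1$. Then all sufficiently large (in absolute value) solutions of $\psi(z)=q$ in $\mathcal Q_1$ are simple, and there exists $m\in\mathbb Z$ such that $$\zeta_{n+m}=\frac1k\left[\ln\left|\frac BA\right|+(a+b)\ln\left(\frac{2n\pi}{k}\right)\right]+\frac{\mathrm i}{k}\left[\arg\left(\frac BA\right)+\left(\tfrac12(a+b)+2n+1\right)\pi\right]+o(1)$$ as $n\to+\infty$.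
   Context: The Laplace exponent of $X$ is defined by $\psi(\mathrm i z)=\ln\mathbb E[\exp(\mathrm i zX_1)]$ for $z\in\mathbb R$ and is given by the Lévy–Khintchine formula $$\psi(z)=\tfrac12\sigma^2z^2+\mu z+\int_{(-\infty,k]}\left(e^{zx}-1-zxh(x)\right)\Pi(\mathrm dx),$$ with $\sigma\ge0$, $\mu\in\mathbb R$, and cutoff function $h\equiv 0$ if $\int_{-1}^1|x|\Pi(\mathrm dx)<\infty$, and otherwise $h(x)=\mathbf 1_{\{x>-1\}}$ (or $h\equiv1$ if $\mathbb E|X_1|<\infty$). This formula defines $\psi$ on $\operatorname{Re}(z)\ge0$, analytically in $\operatorname{Re}(z)>0$. For $q>0$ the equation $\psi(z)=q$ has infinitely many solutions in $\mathcal Q_1$. Powers, logarithms and arguments are principal: the branch cut is along the negative half-line and $\arg(z)\in(-\pi,\pi]$. *)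

(* Defs.v *)
(* The complex field is [R[i]] from real-closed,
   for [R : realType]; topology, derivatives and Landau symbols on it are those
   of the normed module [R[i]^o]. *)
From HB Require Import structures.
From mathcomp Require Import all_boot all_order all_algebra.
From mathcomp Require Import all_classical all_reals all_analysis.
From mathcomp Require Import complex.

Set Implicit Arguments.
Unset Strict Implicit.
Unset Printing Implicit Defensive.

Import Order.TTheory GRing.Theory Num.Theory.
Import numFieldNormedType.Exports.

Local Open Scope classical_set_scope.
Local Open Scope ring_scope.
Local Open Scope complex_scope.

Section ComplexFunctions.
Context {R : realType}.
Implicit Types (z w : R[i]) (f : R[i] -> R[i]).

Definition cmod z : R := Normc.normc z.

Definition cexp z : R[i] :=
  (expR (complex.Re z) * cos (complex.Im z)) +i*
  (expR (complex.Re z) * sin (complex.Im z)).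

(* Principal argument, in ]-pi, pi] for [z != 0]; on the negative half-line
   it is [acos (-1) = pi]. *)
Definition carg z : R :=
  if 0 <= complex.Im z then acos (complex.Re z / cmod z)
  else - acos (complex.Re z / cmod z).

Definition clog z : R[i] := ln (cmod z) +i* carg z.

Definition cpow z w : R[i] := cexp (w * clog z).

Definition Q1 : set R[i] := [set z | 0 < complex.Re z /\ 0 < complex.Im z].

(* The filter "z tends to infinity in Q1". *)
Definition Q1_infty : set_system R[i] :=
  [set S | exists M : R, forall z, Q1 z -> M < cmod z -> S z].

Global Instance Q1_infty_filter : Filter Q1_infty.
Proof.
split; first by exists 0.
- move=> S S' [M SM] [M' SM']; exists (Num.max M M') => z Qz.
  by rewrite gt_max => /andP[Mz M'z]; split; [exact: SM | exact: SM'].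
- by move=> S S' SS' [M SM]; exists M => z Qz Mz; apply/SS'/SM.
Qed.

Canonical Q1_infty_filter_on := FilterType Q1_infty Q1_infty_filter.

(* [z0] is a zero of exact order [m] of [f]; order 0 means [f z0 != 0]. Only
   meant for [f] holomorphic near [z0]: [derive1n] is the iterated complex
   derivative, with default values where a limit does not exist. *)
Definition zero_order f z0 (m : nat) : Prop :=
  (forall j, (j < m)%N -> derive1n j (f : R[i]^o -> R[i]^o) z0 = 0) /\
  derive1n m (f : R[i]^o -> R[i]^o) z0 <> 0.

(* The terms [zeta 1], [zeta 2], ... list the solutions of [f z = c] in [D],
   repeated according to multiplicity, by nondecreasing modulus; [zeta 0] is
   irrelevant. *)
Definition lists_solutions (D : set R[i]) f (c : R[i]) (zeta : nat -> R[i]) :=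
  [/\ forall n, (0 < n)%N -> D (zeta n) /\ f (zeta n) = c,
      forall n, (0 < n)%N -> cmod (zeta n) <= cmod (zeta n.+1) &
      forall z m, D z -> zero_order (fun w => f w - c) z m ->
        ([set n | (0 < n)%N /\ zeta n = z] #= `I_m)%card].

Definition Cintegral d (T : measurableType d)
    (mu : {measure set T -> \bar R}) (D : set T) (g : T -> R[i]) : R[i] :=
  (\int[mu]_(x in D) complex.Re (g x)) +i* (\int[mu]_(x in D) complex.Im (g x)).

End ComplexFunctions.

Section Levy.
Context {R : realType} {d : measure_display} {T : measurableType d}.
Variable P : probability T R.
Implicit Types (X : R -> {RV P >-> R})
  (Pi : {measure set (measurableTypeR R) -> \bar R}).

Definition increment X (s t : R) : T -> R := fun w => X t w - X s w.

(* Mutual independence of the increments over successive intervals; some of the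
   Borel sets [B i] may be the whole line, so this covers all subfamilies. *)
Definition independent_increments X : Prop :=
  forall (n : nat) (t : nat -> R), 0 <= t 0%N ->
    (forall i, (i < n)%N -> t i <= t i.+1) ->
  forall B : nat -> set (measurableTypeR R), (forall i, measurable (B i)) ->
    P (\bigcap_(i in `I_n) (increment X (t i) (t i.+1) @^-1` B i)) =
    (\prod_(i < n) P (increment X (t i) (t i.+1) @^-1` B i))%E.

Definition stationary_increments X : Prop :=
  forall s t : R, 0 <= s -> s <= t ->
  forall B : set (measurableTypeR R), measurable B ->
    P (increment X s t @^-1` B) = P (X (t - s) @^-1` B).

Definition cadlag (x : R -> R) : Prop :=
  (forall t, 0 <= t -> x s @[s --> t^'+] --> x t) /\
  (forall t, 0 < t -> cvg (x s @[s --> t^'-])).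

(* Time is [0, +oo[; the values [X t] for [t < 0] are irrelevant. *)
Definition levy_process X : Prop :=
  [/\ {ae P, forall w, X 0 w = 0},
      independent_increments X,
      stationary_increments X &
      {ae P, forall w, cadlag (fun t => X t w)}].

Definition levy_measure Pi : Prop :=
  Pi [set 0] = 0%E /\ (\int[Pi]_x (Num.min 1 (x ^+ 2))%:E < +oo)%E.

Definition cutoff X Pi (h : R -> R) : Prop :=
  let small_jumps := (\int[Pi]_(x in `[(-1)%R, 1%R]) `|x|%:E)%E in
  ((small_jumps < +oo)%E /\ h = cst 0) \/
  (small_jumps = +oo%E /\
   (h = \1_(`]-1, +oo[) \/
    (('E_P[fun w => `|X 1%R w|%R] < +oo)%E /\ h = cst 1))).

Definition levy_khintchine (sigma mu : R) (h : R -> R) Pi (k : R)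
    (z : R[i]) : R[i] :=
  2^-1 * (sigma ^+ 2)%:C * z ^+ 2 + mu%:C * z +
  Cintegral Pi `]-oo, k]
    (fun x : R => cexp (z * x%:C) - 1 - z * x%:C * (h x)%:C).

(* [X] has Levy measure [Pi], carried by ]-oo, k], and Laplace exponent [psi].
   The logarithm in psi(iz) = ln E[exp(izX_1)] is the continuous one vanishing
   at [z = 0], whence the exponential form; [psi] is unconstrained on Re z < 0,
   where the integral need not converge. *)
Definition laplace_exponent X Pi (k : R) (psi : R[i] -> R[i]) : Prop :=
  exists (sigma mu : R) (h : R -> R),
  [/\ 0 <= sigma,
      levy_measure Pi,
      cutoff X Pi h,
      forall z, 0 <= complex.Re z -> psi z = levy_khintchine sigma mu h Pi k z &
      forall x : R, Cintegral P setT (fun w => cexp ('i * (x * X 1 w)%:C)) =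
                    cexp (psi ('i * x%:C))].

End Levy.

(* Main.v *)
(* Divided by [B exp (b lambda_n)], where [lambda_n = ln (2 n pi / k) + i pi / 2]
   is the leading order of [log z] near the predicted point [P_n], the function
   [psi - q] converges to [1 - exp (k w)], uniformly for [z = P_n + w] with [w]
   bounded.  Since [psi] is locally a uniform limit of its Taylor polynomials,
   Cauchy's estimate turns this into closeness of difference quotients, so that
   Newton's iteration yields exactly one zero near each [P_n], and it is simple.
   Conversely, at a large zero [exp (k z - (a + b) log z)] is close to [- B / A];
   taking logarithms puts [z] near some [P_n].  The large zeros have increasing
   moduli and are listed once each, hence the list eventually runs through them
   in order; being infinite, it contains only finitely many other terms, and no
   information about small zeros is needed.

   The only properties of the Levy process used are the integrability of
   [min 1 x^2] and the shape of the Levy-Khintchine integral.  When changing the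
   cutoff to the indicator of [x > -1] produces a non-integrable term, the real
   and imaginary parts of the integral have the default value 0 on [Q1], so that
   [psi] is a polynomial there. *)
Require Import Defs.
From HB Require Import structures.
From mathcomp Require Import all_boot all_order all_algebra.
From mathcomp Require Import all_classical all_reals all_analysis.
From mathcomp Require Import complex measurable_realfun.
From mathcomp Require Import ring lra zify.

Set Implicit Arguments.
Unset Strict Implicit.
Unset Printing Implicit Defensive.

Import Order.TTheory GRing.Theory Num.Theory.
Import numFieldNormedType.Exports.

Local Open Scope classical_set_scope.
Local Open Scope ring_scope.
Local Open Scope complex_scope.

(** Local analysis is reduced to two finite notions: [poly_approx] carries Cauchy's estimate from
    polynomials to [psi], [quad_derivable] gives the value of the derivative, and both come from one
    Taylor expansion under the Levy integral.

    The normalising factor is frozen at [lambda_n] and does not depend on [w]. Hence the normalised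
    function is affine in [psi] and inherits polynomial approximation on discs, while of the
    logarithm only its size near the imaginary axis is needed.

    Newton's iteration tolerates a Lipschitz defect [k / 2]. Half of it is spent on [1 - exp (k w)]
    not being linear on a small disc of fixed radius, the other half on the distance to this limit.
    Uniqueness in the fixed disc, combined with existence in every smaller one, is what produces the
    o(1).

    The zeros have increasing moduli because consecutive predicted points are [2 pi / k] apart
    vertically, with nondecreasing real parts, and near them the imaginary part dominates the real
    part; small displacements cannot reverse this. *)

Section Modulus.
Context {R : realType}.
Implicit Types z w u v : R[i].

(** * Real part, imaginary part and modulus *)

Lemma cReD z w : complex.Re (z + w) = complex.Re z + complex.Re w.
Proof. by case: z => a b; case: w. Qed.

Lemma cImD z w : complex.Im (z + w) = complex.Im z + complex.Im w.
Proof. by case: z => a b; case: w. Qed.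

Lemma cReN z : complex.Re (- z) = - complex.Re z.
Proof. by case: z. Qed.

Lemma cImN z : complex.Im (- z) = - complex.Im z.
Proof. by case: z. Qed.

Lemma cReM z w : complex.Re (z * w) =
  complex.Re z * complex.Re w - complex.Im z * complex.Im w.
Proof. by case: z => a b; case: w. Qed.

Lemma cImM z w : complex.Im (z * w) =
  complex.Re z * complex.Im w + complex.Im z * complex.Re w.
Proof. by case: z => a b; case: w. Qed.

Lemma cReZ (r : R) z : complex.Re (r%:C * z) = r * complex.Re z.
Proof. by rewrite cReM mul0r subr0. Qed.

Lemma cImZ (r : R) z : complex.Im (r%:C * z) = r * complex.Im z.
Proof. by rewrite cImM mul0r addr0. Qed.

Lemma complex_eqP z w :
  complex.Re z = complex.Re w -> complex.Im z = complex.Im w -> z = w.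
Proof. by case: z => a b; case: w => c d /= -> ->. Qed.

Lemma cmodM z w : cmod (z * w) = cmod z * cmod w.
Proof. exact: Normc.normcM. Qed.

Lemma cmodV z : cmod z^-1 = (cmod z)^-1.
Proof. exact: Normc.normcV. Qed.

Lemma ler_cmodD z w : cmod (z + w) <= cmod z + cmod w.
Proof. exact: le_normcD. Qed.

Lemma cmodN z : cmod (- z) = cmod z.
Proof. exact: normcN. Qed.

Lemma cmod0 : cmod (0 : R[i]) = 0.
Proof. exact: Normc.normc0. Qed.

Lemma cmod1 : cmod (1 : R[i]) = 1.
Proof. exact: Normc.normc1. Qed.

Lemma cmodX z n : cmod (z ^+ n) = cmod z ^+ n.
Proof. by elim: n => [|n IH]; rewrite ?expr0 ?cmod1 // !exprS cmodM IH. Qed.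

Lemma cmod_ge0 z : 0 <= cmod z.
Proof. by case: z => a b; exact: sqrtr_ge0. Qed.

Lemma cmod_eq0 z : (cmod z == 0) = (z == 0).
Proof.
by apply/eqP/eqP => [|->]; [exact: Normc.eq0_normc|exact: cmod0].
Qed.

Lemma cmod_gt0 z : (0 < cmod z) = (z != 0).
Proof. by rewrite lt_neqAle cmod_ge0 andbT eq_sym cmod_eq0. Qed.

Lemma cmodE z : cmod z ^+ 2 = complex.Re z ^+ 2 + complex.Im z ^+ 2.
Proof. by case: z => a b; rewrite sqr_sqrtr // addr_ge0 ?sqr_ge0. Qed.

Lemma cmodC z w : cmod (z - w) = cmod (w - z).
Proof. by rewrite -cmodN opprB. Qed.

Lemma ler_cmodB z w : cmod (z - w) <= cmod z + cmod w.
Proof. by rewrite (le_trans (ler_cmodD _ _)) // cmodN. Qed.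

Lemma ler_cmod_dist z w : cmod z - cmod w <= cmod (z - w).
Proof. by rewrite lerBlDr (le_trans _ (ler_cmodD _ _)) // subrK. Qed.

Lemma cmod_real (x : R) : cmod x%:C = `|x|.
Proof. by rewrite /cmod /= expr0n /= addr0 sqrtr_sqr. Qed.

Lemma normc_cmod z : `|z| = (cmod z)%:C.
Proof. by case: z. Qed.

Lemma ler_Re z : `|complex.Re z| <= cmod z.
Proof.
by rewrite -(@ler_pXn2r _ 2) ?nnegrE ?cmod_ge0 // cmodE real_normK ?num_real //
  lerDl sqr_ge0.
Qed.

Lemma ler_Im z : `|complex.Im z| <= cmod z.
Proof.
by rewrite -(@ler_pXn2r _ 2) ?nnegrE ?cmod_ge0 // cmodE real_normK ?num_real //
  lerDr sqr_ge0.
Qed.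

Lemma cmod_le_ReIm z : cmod z <= `|complex.Re z| + `|complex.Im z|.
Proof.
rewrite -(@ler_pXn2r _ 2) ?nnegrE ?cmod_ge0 ?addr_ge0 // cmodE sqrrD.
rewrite !real_normK ?num_real // lerD2r lerDl mulrn_wge0 // mulr_ge0 //.
Qed.

Lemma ler_cmod_sum (I : Type) (r : seq I) (F : I -> R[i]) :
  cmod (\sum_(i <- r) F i) <= \sum_(i <- r) cmod (F i).
Proof.
elim/big_ind2: _ => [|x a y b xa yb|//]; first by rewrite cmod0.
by rewrite (le_trans (ler_cmodD _ _)) // lerD.
Qed.

(** Cauchy-Schwarz in the plane: the left-hand side is the real part of [z] times the conjugate of
    [w]. *)
Lemma ler_dot z w : complex.Re z * complex.Re w + complex.Im z * complex.Im w
  <= cmod z * cmod w.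
Proof.
have -> : complex.Re z * complex.Re w + complex.Im z * complex.Im w =
  complex.Re (z * (w^*%C)) by case: z w => a b [c d] /=; rewrite mulrN opprK.
have -> : cmod w = cmod (w^*%C) by case: w => c d; rewrite /cmod /= sqrrN.
by rewrite -cmodM (le_trans (ler_norm _)) // ler_Re.
Qed.

End Modulus.

(** * The complex exponential, its periods and the principal logarithm *)

Section Exponential.
Context {R : realType}.
Implicit Types z w u v : R[i].

Lemma cexpD z w : cexp (z + w) = cexp z * cexp w.
Proof.
apply: complex_eqP; rewrite ?cReM ?cImM /= ?cReD ?cImD expRD.
- by rewrite cosD; ring.
- by rewrite sinD; ring.
Qed.

Lemma cexp0 : cexp (0 : R[i]) = 1.
Proof. by apply: complex_eqP; rewrite /= expR0 mul1r ?cos0 ?sin0. Qed.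

Lemma cmod_cexp z : cmod (cexp z) = expR (complex.Re z).
Proof.
apply/eqP; rewrite -(@eqrXn2 _ 2) ?cmod_ge0 ?expR_ge0 // cmodE /= !exprMn.
by rewrite -mulrDr cos2Dsin2 mulr1.
Qed.

Lemma cexp_neq0 z : cexp z != 0.
Proof. by rewrite -cmod_gt0 cmod_cexp expR_gt0. Qed.

Lemma cexp_period z (n : int) : cexp (z + 0 +i* (2 * pi * n%:~R)) = cexp z.
Proof.
have per m : forall z, cexp (z + 0 +i* (2 * pi * m%:R)) = cexp z.
  elim: m => [|m IH] t; first by rewrite mulr0 complexr0 addr0.
  rewrite -[RHS]IH /cexp !cReD !cImD /= -(natr1 m) (mulrDr (2 * pi)) mulr1 addrA.
  have -> : 2 * pi = pi *+ 2 :> R by rewrite mulr_natl.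
  by rewrite cosD2pi sinD2pi.
case: n => m; first exact: per.
rewrite -(per m.+1 (z + _)) -addrA; congr (cexp _).
apply: complex_eqP; rewrite !(cReD, cImD) /= ?addr0 // NegzE.
by rewrite mulrNz; rewrite -pmulrn; ring.
Qed.

Lemma cexp_pi : cexp (0 +i* pi) = (-1 : R[i]).
Proof.
by apply: complex_eqP; rewrite /= expR0 ?cospi ?sinpi ?mul1r ?oppr0.
Qed.

Lemma clogK z : z != 0 -> cexp (clog z) = z.
Proof.
move=> z0; have zp : 0 < cmod z by rewrite cmod_gt0.
have b1 : `|complex.Re z / cmod z| <= 1.
  by rewrite normrM normfV (ger0_norm (cmod_ge0 z)) ler_pdivrMr // mul1r ler_Re.
move: (b1); rewrite ler_norml => b2.
have cos_carg : cos (carg z) = complex.Re z / cmod z.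
  by rewrite /carg; case: ifP => _; rewrite ?cosN acosK // in_itv.
have sin_carg : sin (carg z) = complex.Im z / cmod z.
  have E : Num.sqrt (1 - (complex.Re z / cmod z) ^+ 2) = `|complex.Im z| / cmod z.
    have -> : 1 - (complex.Re z / cmod z) ^+ 2 = (complex.Im z / cmod z) ^+ 2.
      rewrite !expr_div_n -{1}(@divff _ (cmod z ^+ 2)) ?expf_neq0 ?gt_eqF //.
      by rewrite -mulrBl {1}cmodE addrAC subrr add0r.
    by rewrite sqrtr_sqr normrM normfV (ger0_norm (cmod_ge0 z)).
  rewrite /carg; case: ifPn => [i0|]; first by rewrite sin_acos // E ger0_norm.
  by rewrite -ltNge => i0; rewrite sinN sin_acos // E ltr0_norm // mulNr opprK.
apply: complex_eqP; rewrite /= lnK ?posrE // ?cos_carg ?sin_carg mulrC divfK //;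
  by rewrite gt_eqF.
Qed.

Lemma cpowE z (c : R) : cpow z c%:C = cexp (c%:C * clog z).
Proof. by []. Qed.

(** A continuous logarithm at 1, up to periods. The modulus of [cexp v] controls the real part of
    [v]; once the imaginary part is reduced to [[-pi, pi]], monotonicity of the cosine controls it
    as well. *)
Lemma cexp_near1 (e : R) : 0 < e -> exists2 d : R, 0 < d & forall v,
  cmod (cexp v - 1) <= d -> exists n : int, cmod (v - 0 +i* (2 * pi * n%:~R)) <= e.
Proof.
move=> e0; have pi0 : 0 < pi :> R by exact: pi_gt0.
(* Real and imaginary parts get half of [e] each; [t <= pi / 2] makes [cos t] nonnegative, so that
   inequalities may be multiplied by it. *)
pose t : R := Num.min (e / 2) (pi / 2).
have t0 : 0 < t by rewrite lt_min !divr_gt0.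
have tpi2 : t <= pi / 2 by rewrite ge_min lexx orbT.
have tpi : t <= pi by lra.
have ct0 : 0 <= cos t by rewrite cos_ge0_pihalf // tpi2 andbT; lra.
have te : t <= e / 2 by rewrite ge_min lexx.
have ct : cos t < 1.
  rewrite -cos0 ltr_cos // in_itv /= ?lexx ?pi_ge0 // ltW //=.
(* Of the two distances from 1 to [expR (- t)] and to [expR t], this is the smaller one, hence it
   serves both signs of the real part. *)
pose d1 := 1 - expR (- t); have d1p : 0 < d1 by rewrite subr_gt0 expR_lt1 oppr_lt0.
have Et1 : expR t - 1 >= d1.
  rewrite /d1 expRN; have := expR_gt1 t; rewrite t0 => E1.
  have E0 : 0 < expR t by exact: expR_gt0.
  rewrite -subr_ge0.
  have -> : expR t - 1 - (1 - (expR t)^-1) = (expR t - 1) ^+ 2 / expR t.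
    by field; rewrite gt_eqF.
  by rewrite divr_ge0 ?sqr_ge0 // ltW.
pose c1 := 1 - cos t; have c1p : 0 < c1 by rewrite subr_gt0.
exists (Num.min (d1 / 2) (c1 / 4)).
  by rewrite lt_min !divr_gt0.
move=> v; rewrite le_min => /andP[vd vc].
have Re1 (d : R) : cmod (cexp v - 1) <= d -> `|expR (complex.Re v) - 1| <= d.
  apply: le_trans; rewrite -cmod_cexp ler_norml; apply/andP; split.
  - by have := ler_cmod_dist 1 (cexp v); rewrite cmod1 cmodC; lra.
  - by have := ler_cmod_dist (cexp v) 1; rewrite cmod1.
have Re_v : `|complex.Re v| < t.
  have : `|expR (complex.Re v) - 1| < d1.
    by apply: le_lt_trans (Re1 _ vd) _; lra.
  rewrite !ltr_norml => /andP[E1 E2]; apply/andP; split.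
  - by rewrite -ltr_expR; rewrite /d1 in E1; lra.
  - by rewrite -ltr_expR; lra.
pose n := Num.floor ((complex.Im v + pi) / (2 * pi)).
have p2 : 0 < 2 * pi :> R by rewrite mulr_gt0 ?pi_gt0.
have [n1 n2] : n%:~R * (2 * pi) <= complex.Im v + pi /\
     complex.Im v + pi < (n%:~R + 1) * (2 * pi).
  have /andP[] := floor_itv ((complex.Im v + pi) / (2 * pi)).
  by rewrite ler_pdivlMr // ltr_pdivrMr // intrD1.
exists n; pose s := complex.Im v - 2 * pi * n%:~R.
have sb : `|s| <= pi by rewrite ler_norml /s; lra.
have vs : cexp v = cexp (complex.Re v +i* s).
  rewrite -(cexp_period (_ +i* s) n); congr cexp.
  by apply: complex_eqP; rewrite ?cReD ?cImD /= /s ?addr0 // subrK.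
have s_t : `|s| < t.
  (* Otherwise the real part of [cexp v] would be at most [(1 + c1 / 4) * cos t <= 1 - 3 / 4 * c1],
     whereas closeness to 1 makes it at least [1 - c1 / 4]. *)
  rewrite ltNge; apply/negP => ts.
  have cs : cos s <= cos t.
    rewrite -cos_norm leNgt ltr_cos // ?in_itv /= ?normr_ge0 ?(ltW t0) //.
    by rewrite -leNgt.
  have /ler_normlP[_ E] := Re1 _ vc.
  have /ler_normlP[] := le_trans (ler_Re (cexp v - 1)) vc.
  rewrite vs cReD cReN /= => F _; have E0 := expR_gt0 (complex.Re v).
  have : expR (complex.Re v) * cos s <= (1 + c1 / 4) * cos t.
    apply: (@le_trans _ _ (expR (complex.Re v) * cos t)).
      by rewrite ler_wpM2l // ltW.
    by rewrite ler_wpM2r //; lra.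
  have : c1 / 4 * cos t <= c1 / 4 by rewrite ler_piMr ?cos_le1 // divr_ge0 // ltW.
  by rewrite /c1 in c1p F *; lra.
rewrite (le_trans (cmod_le_ReIm _)) // !(cReD, cImD, cReN, cImN) /= subr0.
by rewrite -/s; lra.
Qed.
End Exponential.

(** * Taylor's inequality for the complex exponential *)

Section Taylor.
Context {R : realType}.
Implicit Types z w u v : R[i].

(** Mean value inequality for a plane curve: project the curve on the direction of its total
    increment [D] and apply the real mean value theorem. *)
Lemma cmod_increment (gr gi dgr dgi phi dphi : R -> R) (t : R) : 0 <= t ->
  (forall x : R, is_derive x 1 gr (dgr x)) -> (forall x : R, is_derive x 1 gi (dgi x)) ->
  (forall x : R, is_derive x 1 phi (dphi x)) ->
  (forall x, 0 <= x <= t -> cmod (dgr x +i* dgi x) <= dphi x) ->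
  cmod ((gr t - gr 0) +i* (gi t - gi 0)) <= phi t - phi 0.
Proof.
move=> t0 hr hi hp hb.
set D := _ +i* _.
have [->|D0] := eqVneq D 0.
  rewrite cmod0.
  have cp : {within `[0, t], continuous phi}.
    by apply: derivable_within_continuous => x _; have [] := hp x.
  have [c ct ->] := MVT_segment t0 (fun x _ => hp x) cp.
  rewrite subr0 mulr_ge0 // (le_trans (cmod_ge0 _) (hb c _)) //.
have Dp : 0 < cmod D by rewrite cmod_gt0.
(* Cauchy-Schwarz makes the derivative of [H] nonnegative on [[0, t]], and [H t - H 0] equals
   [cmod D * (phi t - phi 0) - cmod D ^+ 2]. *)
pose H (x : R) := cmod D * phi x - (complex.Re D * gr x + complex.Im D * gi x).
pose dH (x : R) := cmod D * dphi x - (complex.Re D * dgr x + complex.Im D * dgi x).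
have hH (x : R) : is_derive x 1 H (dH x).
  rewrite /H /dH.
  have := hr x; have := hi x; have := hp x => ? ? ?.
  apply: is_deriveB.
have cH : {within `[0, t], continuous H}.
  by apply: derivable_within_continuous => x _; have [] := hH x.
have [c ct E] := MVT_segment t0 (fun x _ => hH x) cH.
have : 0 <= H t - H 0.
  rewrite E subr0 mulr_ge0 // /dH subr_ge0.
  apply: le_trans (ler_dot D (dgr c +i* dgi c)) _.
  by rewrite ler_wpM2l ?cmod_ge0 // hb.
rewrite /H => H0; rewrite -(ler_pM2l Dp) -expr2 cmodE -subr_ge0.
apply: le_trans H0 _; rewrite le_eqVlt; apply/orP; left; apply/eqP.
by rewrite /D /=; ring.
Qed.

Definition exp_poly v M : R[i] := \sum_(n < M) v ^+ n / n`!%:R.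

(** Partial sums of the series of [cexp (t v)] along a ray: differentiating in [t] multiplies by [v]
    and lowers the order by one, which is what the induction in [taylor_aux] runs on. *)
Let P v M (t : R) : R[i] := \sum_(n < M) (t ^+ n / n`!%:R)%:C * v ^+ n.

Let PS v M t : P v M.+1 t = P v M t + (t ^+ M / M`!%:R)%:C * v ^+ M.
Proof. by rewrite /P big_ord_recr. Qed.

Let is_derive_mono (k t : R) n :
  is_derive t 1 (fun s => k * s ^+ n.+1) (k * (n.+1%:R * t ^+ n)).
Proof.
have -> : (fun s => k * s ^+ n.+1) = k \*: (id ^+ n.+1).
  by apply/funext => s; rewrite /= exprfctE.
by apply: is_derive_eq; rewrite /GRing.scale /= mulr1.
Qed.

Let is_derive_P v M (t : R) :
  is_derive t 1 (fun t : R => complex.Re (P v M.+1 t)) (complex.Re (v * P v M t)) /\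
  is_derive t 1 (fun t : R => complex.Im (P v M.+1 t)) (complex.Im (v * P v M t)).
Proof.
elim: M => [|M [IHr IHi]].
  have -> : (fun t : R => complex.Re (P v 1 t)) = cst 1.
    by apply/funext => x; rewrite /P big_ord1 !expr0 fact0 divr1 mulr1.
  have -> : (fun t : R => complex.Im (P v 1 t)) = cst 0.
    by apply/funext => x; rewrite /P big_ord1 !expr0 fact0 divr1 mulr1.
  by rewrite /P big_ord0 mulr0; split; exact: is_derive_cst.
have mono (c : R) : is_derive t 1 (fun t : R => c * (t ^+ M.+1 / M.+1`!%:R))
    (c * (t ^+ M / M`!%:R)).
  have -> : (fun t : R => c * (t ^+ M.+1 / M.+1`!%:R)) =
            (fun t : R => (c / M.+1`!%:R) * t ^+ M.+1).
    by apply/funext => x; ring.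
  have -> : c * (t ^+ M / M`!%:R) = c / M.+1`!%:R * (M.+1%:R * t ^+ M).
    rewrite factS natrM; field.
    by rewrite pnatr_eq0 -lt0n fact_gt0 addrC natr1 pnatr_eq0.
  exact: is_derive_mono.
split.
  have -> : (fun t : R => complex.Re (P v M.+2 t)) = (fun t : R => complex.Re (P v M.+1 t)) \+
     (fun t : R => complex.Re (v ^+ M.+1) * (t ^+ M.+1 / M.+1`!%:R)).
    by apply/funext => x; rewrite PS cReD cReZ [X in _ + X]mulrC.
  have -> : complex.Re (v * P v M.+1 t) = complex.Re (v * P v M t) +
      complex.Re (v ^+ M.+1) * (t ^+ M / M`!%:R).
    by rewrite PS mulrDr cReD mulrCA -exprS cReZ [X in _ + X]mulrC.
  exact: is_deriveD.
have -> : (fun t : R => complex.Im (P v M.+2 t)) = (fun t : R => complex.Im (P v M.+1 t)) \+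
     (fun t : R => complex.Im (v ^+ M.+1) * (t ^+ M.+1 / M.+1`!%:R)).
  by apply/funext => x; rewrite PS cImD cImZ [X in _ + X]mulrC.
have -> : complex.Im (v * P v M.+1 t) = complex.Im (v * P v M t) +
      complex.Im (v ^+ M.+1) * (t ^+ M / M`!%:R).
  by rewrite PS mulrDr cImD mulrCA -exprS cImZ [X in _ + X]mulrC.
exact: is_deriveD.
Qed.

Let is_derive_cexp v (t : R) :
  is_derive t 1 (fun t : R => complex.Re (cexp (t%:C * v)))
    (complex.Re (v * cexp (t%:C * v))) /\
  is_derive t 1 (fun t : R => complex.Im (cexp (t%:C * v)))
    (complex.Im (v * cexp (t%:C * v))).
Proof.
case: v => x y.
have -> : (fun t : R => complex.Re (cexp (t%:C * (x +i* y)))) =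
  (fun t : R => expR (t * x) * cos (t * y)).
  by apply/funext => s /=; rewrite !mul0r subr0 addr0.
have -> : (fun t : R => complex.Im (cexp (t%:C * (x +i* y)))) =
  (fun t : R => expR (t * x) * sin (t * y)).
  by apply/funext => s /=; rewrite !mul0r subr0 addr0.
rewrite !cReM !cImM /= !mul0r !subr0 !addr0.
have lin (c : R) : is_derive t 1 (fun t : R => t * c) c.
  have -> : (fun t : R => t * c) = (fun t : R => c * t) by apply/funext => s; rewrite mulrC.
  by have := is_derive_mono c t 0; rewrite expr0 mulr1 mulr1.
have dE : is_derive t 1 (fun t : R => expR (t * x)) (x * expR (t * x)).
  have h := @is_derive1_comp _ expR (fun t : R => t * x) t _ _ (is_derive_expR _) (lin x).
  by apply: (is_derive_eq h); rewrite mulrC.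
have dc : is_derive t 1 (fun t : R => cos (t * y)) (- y * sin (t * y)).
  have h := @is_derive1_comp _ cos (fun t : R => t * y) t _ _ (is_derive_cos _) (lin y).
  by apply: (is_derive_eq h); ring.
have ds : is_derive t 1 (fun t : R => sin (t * y)) (y * cos (t * y)).
  have h := @is_derive1_comp _ sin (fun t : R => t * y) t _ _ (is_derive_sin _) (lin y).
  by apply: (is_derive_eq h); ring.
by split; [apply: (is_derive_eq (is_deriveM dE dc))|apply: (is_derive_eq (is_deriveM dE ds))];
  rewrite /GRing.scale /=; ring.
Qed.

(** The derivative of the remainder of order [M + 1] is [v] times that of order [M]; [dphi] is the
    induction hypothesis multiplied by [cmod v], and [phi] its antiderivative. *)
Let taylor_aux v M (t : R) : 0 <= t <= 1 ->
  cmod (cexp (t%:C * v) - P v M t) <= t ^+ M / M`!%:R * cmod v ^+ M * expR (cmod v).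
Proof.
elim: M t => [|M IH] t /andP[t0 t1].
  rewrite /P big_ord0 subr0 !expr0 fact0 divr1 !mul1r cmod_cexp ler_expR cReM /=.
  rewrite mul0r subr0 (le_trans (ler_norm _)) // normrM ger0_norm //.
  by rewrite (le_trans _ (ler_Re v)) // ler_piMl.
have [d1 d2] := (is_derive_cexp v, is_derive_P v M).
pose gr (s : R) := complex.Re (cexp (s%:C * v)) - complex.Re (P v M.+1 s).
pose gi (s : R) := complex.Im (cexp (s%:C * v)) - complex.Im (P v M.+1 s).
pose g (s : R) := v * (cexp (s%:C * v) - P v M s).
pose phi (s : R) : R := cmod v ^+ M.+1 * expR (cmod v) / M.+1`!%:R * s ^+ M.+1.
pose dphi (s : R) : R := cmod v ^+ M.+1 * expR (cmod v) / M`!%:R * s ^+ M.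
have := @cmod_increment gr gi (fun s => complex.Re (g s))
  (fun s => complex.Im (g s)) phi dphi t t0.
have gr0 : gr 0 = 0.
  rewrite /gr mul0r cexp0 /P big_ord_recl big1 ?addr0; last first.
    by move=> i _; rewrite exprS !mul0r.
  by rewrite !expr0 fact0 divr1 mulr1 subrr.
have gi0 : gi 0 = 0.
  rewrite /gi mul0r cexp0 /P big_ord_recl big1 ?addr0; last first.
    by move=> i _; rewrite exprS !mul0r.
  by rewrite !expr0 fact0 divr1 mulr1 subrr.
have phi0 : phi 0 = 0 by rewrite /phi expr0n mulr0.
rewrite gr0 gi0 phi0 !subr0.
have -> : gr t +i* gi t = cexp (t%:C * v) - P v M.+1 t.
  by apply: complex_eqP; rewrite ?(cReD, cImD, cReN, cImN).
have -> : phi t = t ^+ M.+1 / M.+1`!%:R * cmod v ^+ M.+1 * expR (cmod v).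
  by rewrite /phi; ring.
apply.
- move=> x; rewrite /g mulrBr cReD cReN; have [? _] := d1 x; have [? _] := d2 x.
  exact: is_deriveB.
- move=> x; rewrite /g mulrBr cImD cImN; have [_ ?] := d1 x; have [_ ?] := d2 x.
  exact: is_deriveB.
- move=> x; rewrite /phi.
  have h := is_derive_mono (cmod v ^+ M.+1 * expR (cmod v) / M.+1`!%:R) x M.
  apply: (is_derive_eq h); rewrite /dphi factS natrM; field.
  by rewrite pnatr_eq0 -lt0n fact_gt0 addrC natr1 pnatr_eq0.
- move=> x /andP[x0 xt]; have -> : complex.Re (g x) +i* complex.Im (g x) = g x by case: (g x).
  rewrite /g cmodM /dphi.
  have -> : cmod v ^+ M.+1 * expR (cmod v) / M`!%:R * x ^+ M =
    cmod v * (x ^+ M / M`!%:R * cmod v ^+ M * expR (cmod v)) by rewrite exprS; ring.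
  by rewrite ler_wpM2l ?cmod_ge0 // IH // x0 (le_trans xt).
Qed.

Lemma cexp_taylor v M :
  cmod (cexp v - exp_poly v M) <= cmod v ^+ M / M`!%:R * expR (cmod v).
Proof.
have := @taylor_aux v M 1; rewrite ler01 lexx mul1r expr1n => /(_ isT).
have -> : P v M 1 = exp_poly v M.
  apply: eq_bigr => n _; rewrite expr1n mul1r fmorphV rmorph_nat mulrC //.
by rewrite (_ : 1 / _ * _ * _ = cmod v ^+ M / M`!%:R * expR (cmod v)) //; ring.
Qed.

Lemma exp_poly1 v : exp_poly v 1 = 1.
Proof. by rewrite /exp_poly big_ord1 expr0 fact0 divr1. Qed.

Lemma exp_poly2 v : exp_poly v 2 = 1 + v.
Proof.
by rewrite /exp_poly !big_ord_recl big_ord0 /= expr0 expr1 fact0 !divr1 addr0.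
Qed.

Lemma expR_le4 (x : R) : x <= 1 -> expR x <= 4.
Proof.
move=> x1; apply: (@le_trans _ _ (expR (2 * 2^-1 : R))).
  by rewrite ler_expR mulfV.
have := expR_ge1Dx (- (2^-1) : R); rewrite expRN => h.
have e0 : 0 < expR 2^-1 :> R := expR_gt0 _.
have : expR 2^-1 <= 2 :> R.
  by rewrite -[leLHS]invrK -[leRHS]invrK lef_pV2 ?posrE ?invr_gt0 //; lra.
by rewrite expRM_natl => h3; nra.
Qed.

Lemma cexp_sub1_le z (e : R) : cmod z <= e -> e <= 1 -> cmod (cexp z - 1) <= 4 * e.
Proof.
move=> ze e1; have := cexp_taylor z 1; rewrite exp_poly1 => /le_trans; apply.
rewrite expr1 divr1 mulrC ler_pM ?expR_ge0 ?cmod_ge0 //.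
by rewrite expR_le4 // (le_trans ze).
Qed.

End Taylor.

(** * Cauchy's estimate for uniform limits of polynomials *)

Section PolyApprox.
Context {R : realType}.
Implicit Types (z w u v : R[i]) (p : {poly R[i]}) (F G : R[i] -> R[i]).

Lemma horner_even_odd p w :
  p.[w] = (even_poly p).[w ^+ 2] + (odd_poly p).[w ^+ 2] * w.
Proof.
rewrite -[in LHS](poly_even_odd p) hornerD hornerM hornerX.
by rewrite !horner_comp hornerXn.
Qed.

(* Cauchy's estimate, by induction on the degree: a bound for [p] on the circle
   of radius [r] passes to its even and odd parts on the circle of radius
   [r ^+ 2]. *)
Lemma poly_coef_le p (r S : R) n : 0 < r ->
  (forall w, cmod w = r -> cmod p.[w] <= S) -> cmod p`_n * r ^+ n <= S.
Proof.
move: {2}(size p).+1 (ltnSn (size p)) => m.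
elim: m p r S n => // m IH p r S n pm r0 pS.
have r_real : cmod r%:C = r by rewrite cmod_real gtr0_norm.
(* Constants are split off because halving decreases the size only from 2 on. *)
have [p1|p1] := leqP (size p) 1.
  have := size1_polyC p1; move: (p`_0) => c pc.
  have := pS _ r_real; rewrite pc hornerC coefC => cS.
  case: eqP => [->|_]; first by rewrite expr0 mulr1.
  by rewrite cmod0 mul0r (le_trans (cmod_ge0 _) cS).
have half_lt : (uphalf (size p) < size p)%N by lia.
have r20 : 0 < r ^+ 2 by rewrite exprn_gt0.
have sq u : cmod u = r ^+ 2 -> exists2 w, w ^+ 2 = u & cmod w = r.
  move=> ur; exists (sqrtc u); first by rewrite sqr_sqrtc.
  apply/eqP; rewrite -(@eqrXn2 _ 2) ?cmod_ge0 ?(ltW r0) //.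
  by rewrite -cmodX sqr_sqrtc ur.
have two (x : R[i]) : cmod (x + x) = 2 * cmod x.
  have -> : x + x = 2%:C * x by rewrite rmorph_nat mulr_natl mulr2n.
  by rewrite cmodM cmod_real ger0_norm.
have even_le u : cmod u = r ^+ 2 -> cmod (even_poly p).[u] <= S.
  move=> /sq[w <- wr]; rewrite -(@ler_pM2l _ 2) // -two.
  have -> : (even_poly p).[w ^+ 2] + (even_poly p).[w ^+ 2] = p.[w] + p.[- w].
    by rewrite !(horner_even_odd p) sqrrN; ring.
  rewrite (le_trans (ler_cmodD _ _)) // mulr_natl mulr2n lerD ?pS //.
  by rewrite cmodN.
have odd_le u : cmod u = r ^+ 2 -> cmod (odd_poly p).[u] <= S / r.
  move=> /sq[w <- wr]; rewrite ler_pdivlMr // -(@ler_pM2l _ 2) // -{1}wr -cmodM -two.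
  have -> : (odd_poly p).[w ^+ 2] * w + (odd_poly p).[w ^+ 2] * w = p.[w] - p.[- w].
    by rewrite !(horner_even_odd p) sqrrN; ring.
  rewrite (le_trans (ler_cmodB _ _)) // mulr_natl mulr2n lerD ?pS //.
  by rewrite cmodN.
rewrite -(odd_double_half n); case: (odd n); rewrite ?add1n ?add0n.
- rewrite -coef_odd_poly exprS -mul2n exprM mulrCA -ler_pdivlMl // mulrC [X in _ <= X]mulrC.
  rewrite mulrC; apply: IH => //; apply: leq_ltn_trans (size_odd_poly p) _.
  by lia.
- rewrite -coef_even_poly -mul2n exprM.
  by apply: IH => //; apply: leq_ltn_trans (size_even_poly p) _; lia.
Qed.

Lemma geometric_le (t : R) n : 0 <= t <= 2^-1 -> \sum_(i < n) t ^+ i <= 2 * (1 - t ^+ n).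
Proof.
move=> /andP[t0 t2]; elim: n => [|n IH]; first by rewrite big_ord0 expr0 subrr mulr0.
rewrite big_ord_recr /= exprS; have tn : 0 <= t ^+ n by rewrite exprn_ge0.
have : t * t ^+ n <= 2^-1 * t ^+ n by rewrite ler_wpM2r.
by lra.
Qed.

(** The [n]-th coefficient is at most [S / r ^+ n], so the difference is dominated by a geometric
    series of ratio [cmod w / r <= 1 / 2]; hence the half disc and the factor 2. *)
Lemma poly_lipschitz p (r S : R) w : 0 < r ->
  (forall w, cmod w <= r -> cmod p.[w] <= S) -> cmod w <= r / 2 ->
  cmod (p.[w] - p.[0]) <= 2 * S * cmod w / r.
Proof.
move=> r0 pS wr; have S0 : 0 <= S.
  by rewrite (le_trans (cmod_ge0 p.[0])) // pS // cmod0 ltW.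
have coef_le n : cmod p`_n <= S / r ^+ n.
  rewrite ler_pdivlMr ?exprn_gt0 //; apply: poly_coef_le => // v vr.
  by rewrite pS // vr.
rewrite horner_coef0 horner_coef.
case pn: (size p) => [|n].
  move/eqP: pn; rewrite size_poly_eq0 => /eqP ->.
  rewrite big_ord0 coef0 subr0 cmod0.
  by rewrite divr_ge0 ?mulr_ge0 ?cmod_ge0 // ltW.
rewrite big_ord_recl expr0 mulr1 addrC addKr (le_trans (ler_cmod_sum _ _)) //.
pose t := cmod w / r.
have t0 : 0 <= t <= 2^-1.
  by rewrite divr_ge0 ?cmod_ge0 ?(ltW r0) //= ler_pdivrMr // mulrC.
apply: (@le_trans _ _ (\sum_(i < n) S * t * t ^+ i)).
  apply: ler_sum => i _; rewrite cmodM cmodX /= /bump /= add1n.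
  apply: (@le_trans _ _ (S / r ^+ i.+1 * cmod w ^+ i.+1)).
    by rewrite ler_wpM2r ?exprn_ge0 ?cmod_ge0.
  by rewrite -[leRHS]mulrA -exprS /t expr_div_n mulrAC mulrA.
rewrite -mulr_sumr.
apply: (@le_trans _ _ (S * t * 2)); last first.
  by rewrite /t le_eqVlt; apply/orP; left; apply/eqP; ring.
case/andP: (t0) => t1 _.
apply: ler_wpM2l; first exact: mulr_ge0.
apply: (le_trans (geometric_le n t0)).
by rewrite ler_piMr // gerBl exprn_ge0.
Qed.

(** Plays the part of analyticity on the disc of centre [z]: it is stable under linear combinations
    and lets bounds on the disc control difference quotients. *)
Definition poly_approx F z (r : R) := forall e : R, 0 < e -> exists p,
  forall w, cmod w <= r -> cmod (F (z + w) - p.[w]) <= e.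

Lemma poly_approx_lipschitz F z (r S : R) w : 0 < r -> poly_approx F z r ->
  (forall w, cmod w <= r -> cmod (F (z + w)) <= S) -> cmod w <= r / 2 ->
  cmod (F (z + w) - F z) <= 2 * S * cmod w / r.
Proof.
move=> r0 Fp FS wr; rewrite leNgt; apply/negP => lt.
(* A quarter of the supposed excess: replacing [F] by [p] costs [e] at each of the two points, and
   the bound [S + e] instead of [S] costs at most one more. *)
pose e := (cmod (F (z + w) - F z) - 2 * S * cmod w / r) / 4.
have e0 : 0 < e by rewrite divr_gt0 // subr_gt0.
have [p pF] := Fp e e0.
have wr' : cmod w <= r by lra.
have E0 := pF 0; rewrite addr0 cmod0 in E0; have {}E0 := E0 (ltW r0).
have Ew := pF w wr'.
have pS v : cmod v <= r -> cmod p.[v] <= S + e.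
  move=> vr; rewrite -[p.[v]](subKr (F (z + v))) (le_trans (ler_cmodB _ _)) //.
  by rewrite lerD // ?FS // pF.
have := poly_lipschitz r0 pS wr.
have -> : 2 * (S + e) * cmod w / r = 2 * S * cmod w / r + 2 * e * (cmod w / r).
  by field; rewrite gt_eqF.
have : 2 * e * (cmod w / r) <= 2 * e * 2^-1.
  have h : cmod w / r <= 2^-1 by rewrite ler_pdivrMr // mulrC.
  by rewrite ler_wpM2l // mulr_ge0 // ltW.
have : cmod (F (z + w) - F z) <= e + cmod (p.[w] - p.[0]) + e.
  have -> : F (z + w) - F z = (F (z + w) - p.[w]) + (p.[w] - p.[0]) - (F z - p.[0]) by ring.
  rewrite (le_trans (ler_cmodB _ _)) // lerD // (le_trans (ler_cmodD _ _)) //.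
  by rewrite lerD.
by rewrite /e in e0 *; lra.
Qed.

Lemma poly_approxD F G z r : poly_approx F z r -> poly_approx G z r ->
  poly_approx (fun w => F w + G w) z r.
Proof.
move=> hF hG e e0; have e2 : 0 < e / 2 by lra.
have [p hp] := hF _ e2; have [q hq] := hG _ e2.
exists (p + q) => w wr; rewrite hornerD.
have -> : F (z + w) + G (z + w) - (p.[w] + q.[w]) =
  (F (z + w) - p.[w]) + (G (z + w) - q.[w]) by ring.
by rewrite (le_trans (ler_cmodD _ _)) // [e]splitr lerD ?hp ?hq.
Qed.

Lemma poly_approxZ F c z r : poly_approx F z r ->
  poly_approx (fun w => c * F w) z r.
Proof.
move=> hF e e0; have c1 : 0 < cmod c + 1 by rewrite ltr_wpDl ?cmod_ge0.
have [p hp] := hF _ (divr_gt0 e0 c1).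
exists (c *: p) => w wr; rewrite hornerZ -mulrBr cmodM.
apply: (@le_trans _ _ ((cmod c + 1) * (e / (cmod c + 1)))).
  by rewrite ler_pM ?cmod_ge0 ?hp // lerDl.
by rewrite mulrC divfK // gt_eqF.
Qed.

Lemma poly_approx_horner p z r : poly_approx (fun w => p.[w]) z r.
Proof.
move=> e e0; exists (p \Po ('X + z%:P)) => w _.
by rewrite horner_comp hornerD hornerX hornerC (addrC z) subrr cmod0 ltW.
Qed.

Lemma poly_approx_cst c z r : poly_approx (fun=> c) z r.
Proof.
by move=> e e0; exists c%:P => w _; rewrite hornerC subrr cmod0 ltW.
Qed.

Lemma half_expn_small (C e : R) : 0 < e -> exists M : nat, C * 2^-1 ^+ M.+2 <= e.
Proof.
move=> e0; exists (Num.trunc (`|C| / e)).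
set M := Num.trunc _.
have : `|C| / e < M.+1%:R by rewrite truncnS_gt.
rewrite ltr_pdivrMr // => CM.
rewrite exprVn ler_pdivrMr ?exprn_gt0 // (le_trans (ler_norm _)) // (le_trans (ltW CM)) //.
rewrite mulrC ler_wpM2l ?(ltW e0) // -natrX ler_nat.
by apply: leq_trans (ltnW (ltn_expl M.+2 (isT : 1 < 2)%N)).
Qed.

Lemma expn_fact_le (x : R) n : 0 <= x -> x ^+ n / n`!%:R <= expR x.
Proof.
move=> x0; case: n => [|n].
  by rewrite expr0 fact0 divr1 -expR0 ler_expR.
by rewrite (le_trans _ (expR_ge1Dxn n x0)) // lerDr.
Qed.

(** Geometric decay in [n], bought by doubling the exponent: this is [expn_fact_le] at [2 * x]. *)
Lemma expn_fact_half (x : R) n : 0 <= x ->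
  x ^+ n / n`!%:R <= 2^-1 ^+ n * expR (2 * x).
Proof.
move=> x0; have := @expn_fact_le (2 * x) n; rewrite mulr_ge0 // => /(_ isT).
rewrite exprMn -mulrA -ler_pdivlMl ?exprn_gt0 // => h.
by rewrite exprVn.
Qed.

Lemma poly_approx_cexp c z (r : R) : poly_approx (fun w => cexp (c * w)) z r.
Proof.
have -> : (fun w => cexp (c * w)) = (fun w => cexp (c * z) * cexp (c * (w - z))).
  by apply/funext => w; rewrite -cexpD -mulrDr subrKC.
apply: poly_approxZ => e e0.
pose x := cmod c * `|r|; have x0 : 0 <= x by rewrite mulr_ge0 ?cmod_ge0.
have [M hM] := half_expn_small (expR (2 * x) * expR x) e0.
exists (\poly_(n < M.+2) (c ^+ n / n`!%:R)) => w wr.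
have -> : (\poly_(n < M.+2) (c ^+ n / n`!%:R)).[w] = exp_poly (c * w) M.+2.
  by rewrite horner_poly; apply: eq_bigr => n _; rewrite exprMn mulrAC.
rewrite (addrC z) addrK (le_trans (cexp_taylor _ _)) //.
have cw : cmod (c * w) <= x.
  by rewrite cmodM ler_wpM2l ?cmod_ge0 // (le_trans wr) // ler_norm.
apply: le_trans hM; rewrite [X in _ <= X]mulrC mulrA ler_pM ?expR_ge0 ?ler_expR //.
  by rewrite divr_ge0 ?exprn_ge0 ?cmod_ge0.
rewrite (le_trans (expn_fact_half _ (cmod_ge0 _))) // ler_wpM2l ?exprn_ge0 //.
by rewrite ler_expR ler_wpM2l.
Qed.

End PolyApprox.

(** * Measurability and integration of complex-valued functions *)

Section ComplexIntegral.
Context {R : realType} {d : measure_display} {T : measurableType d}.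
Variable mu : {measure set T -> \bar R}.
Implicit Types (D : set T) (f g : T -> R[i]) (F : T -> R).

Definition cmeasurable D f :=
  measurable_fun D (fun x => complex.Re (f x)) /\
  measurable_fun D (fun x => complex.Im (f x)).

Definition cintegrable D f :=
  mu.-integrable D (EFin \o (fun x => complex.Re (f x))) /\
  mu.-integrable D (EFin \o (fun x => complex.Im (f x))).

Lemma cmeasurable_cst D (c : R[i]) : cmeasurable D (fun=> c).
Proof. by split; exact: measurable_cst. Qed.

Lemma cmeasurable_real D F : measurable_fun D F ->
  cmeasurable D (fun x => (F x)%:C).
Proof. by split => //; exact: measurable_cst. Qed.

Lemma cmeasurableD D f g : cmeasurable D f -> cmeasurable D g ->
  cmeasurable D (fun x => f x + g x).
Proof.
move=> [f1 f2] [g1 g2]; split; under eq_fun do rewrite ?cReD ?cImD;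
  exact: measurable_funD.
Qed.

Lemma cmeasurableN D f : cmeasurable D f -> cmeasurable D (fun x => - f x).
Proof.
move=> [f1 f2]; split; under eq_fun do rewrite ?cReN ?cImN;
  exact: measurableT_comp.
Qed.

Lemma cmeasurableM D f g : cmeasurable D f -> cmeasurable D g ->
  cmeasurable D (fun x => f x * g x).
Proof.
move=> [f1 f2] [g1 g2]; split; under eq_fun do rewrite ?cReM ?cImM.
- by apply: measurable_funB; exact: measurable_funM.
- by apply: measurable_funD; exact: measurable_funM.
Qed.

Lemma cmeasurable_cexp D f : cmeasurable D f -> cmeasurable D (fun x => cexp (f x)).
Proof.
move=> [f1 f2]; split => /=; apply: measurable_funM.
- exact: measurableT_comp f1.
- apply: measurableT_comp f2; apply: continuous_measurable_fun; exact: continuous_cos.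
- exact: measurableT_comp f1.
- apply: measurableT_comp f2; apply: continuous_measurable_fun; exact: continuous_sin.
Qed.

Lemma cintegrable_dominated D f F : measurable D -> cmeasurable D f ->
  mu.-integrable D (EFin \o F) -> (forall x, D x -> cmod (f x) <= F x) ->
  cintegrable D f.
Proof.
move=> mD [f1 f2] iF fF; split; apply: (le_integrable mD _ _ iF).
- exact/measurable_EFinP.
- move=> x Dx /=; rewrite lee_fin (le_trans (ler_Re _)) //.
  by rewrite (le_trans (fF x Dx)) // ler_norm.
- exact/measurable_EFinP.
- move=> x Dx /=; rewrite lee_fin (le_trans (ler_Im _)) //.
  by rewrite (le_trans (fF x Dx)) // ler_norm.
Qed.

Lemma cintegrableD D f g : measurable D -> cintegrable D f -> cintegrable D g ->
  cintegrable D (fun x => f x + g x).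
Proof.
move=> mD [f1 f2] [g1 g2]; split.
- rewrite (_ : _ \o _ = (EFin \o (fun x => complex.Re (f x))) \+
    (EFin \o (fun x => complex.Re (g x))))%E; first exact: integrableD.
  by apply/funext => x /=; rewrite cReD EFinD.
- rewrite (_ : _ \o _ = (EFin \o (fun x => complex.Im (f x))) \+
    (EFin \o (fun x => complex.Im (g x))))%E; first exact: integrableD.
  by apply/funext => x /=; rewrite cImD EFinD.
Qed.

Lemma integrable_Zl D F (r : R) : measurable D -> mu.-integrable D (EFin \o F) ->
  mu.-integrable D (EFin \o (fun x => r * F x)).
Proof.
move=> mD iF; rewrite (_ : _ \o _ = (fun x => r%:E * (EFin \o F) x))%E.
  exact: integrableZl.
by apply/funext => x /=; rewrite EFinM.
Qed.

Lemma cintegrableZ D f (c : R[i]) : measurable D -> cintegrable D f ->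
  cintegrable D (fun x => c * f x).
Proof.
move=> mD [f1 f2]; split.
- rewrite (_ : _ \o _ = (EFin \o (fun x => (complex.Re c * complex.Re (f x))%R)) \+
    (EFin \o (fun x => (- complex.Im c * complex.Im (f x))%R)))%E; last first.
    by apply/funext => x /=; rewrite cReM -EFinD mulNr.
  by apply: integrableD => //; exact: integrable_Zl.
- rewrite (_ : _ \o _ = (EFin \o (fun x => (complex.Re c * complex.Im (f x))%R)) \+
    (EFin \o (fun x => (complex.Im c * complex.Re (f x))%R)))%E; last first.
    by apply/funext => x /=; rewrite cImM -EFinD.
  by apply: integrableD => //; exact: integrable_Zl.
Qed.

Lemma CintegralD D f g : measurable D -> cintegrable D f -> cintegrable D g ->
  Cintegral mu D (fun x => f x + g x) = Cintegral mu D f + Cintegral mu D g.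
Proof.
move=> mD [f1 f2] [g1 g2]; apply: complex_eqP; rewrite ?cReD ?cImD /=.
- by under eq_Rintegral do rewrite cReD; exact: RintegralD.
- by under eq_Rintegral do rewrite cImD; exact: RintegralD.
Qed.

Lemma CintegralZ D f (c : R[i]) : measurable D -> cintegrable D f ->
  Cintegral mu D (fun x => c * f x) = c * Cintegral mu D f.
Proof.
move=> mD [f1 f2]; apply: complex_eqP; rewrite ?cReM ?cImM /=.
- under eq_Rintegral do rewrite cReM.
  by rewrite RintegralB ?RintegralZl //; exact: integrable_Zl.
- under eq_Rintegral do rewrite cImM.
  by rewrite RintegralD ?RintegralZl //; exact: integrable_Zl.
Qed.

Lemma cintegrable_Cintegral_sum D (h : nat -> T -> R[i]) (c : nat -> R[i]) n :
  measurable D -> (forall i, cintegrable D (h i)) ->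
  cintegrable D (fun x => \sum_(i < n) c i * h i x) /\
  Cintegral mu D (fun x => \sum_(i < n) c i * h i x) =
    \sum_(i < n) c i * Cintegral mu D (h i).
Proof.
move=> mD ih; elim: n => [|n [IH1 IH2]].
  rewrite big_ord0 (_ : (fun x => \sum_(i < 0) c i * h i x) = (fun=> 0)); last first.
    by apply/funext => x; rewrite big_ord0.
  split; first by split => /=; exact: integrable0.
  by apply: complex_eqP; rewrite /= /Rintegral integral0.
have E : (fun x => \sum_(i < n.+1) c i * h i x) =
    (fun x => \sum_(i < n) c i * h i x + c n * h n x).
  by apply/funext => x; rewrite big_ord_recr.
have iZ : cintegrable D (fun x => c n * h n x) by exact: cintegrableZ.
rewrite E big_ord_recr /=; split; first exact: cintegrableD.
by rewrite CintegralD // CintegralZ // IH2.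
Qed.

(** The factor 2 comes from bounding the real and imaginary parts separately. *)
Lemma cmod_Cintegral_le D f F : measurable D -> cintegrable D f ->
  mu.-integrable D (EFin \o F) -> (forall x, D x -> cmod (f x) <= F x) ->
  cmod (Cintegral mu D f) <= 2 * \int[mu]_(x in D) F x.
Proof.
move=> mD [f1 f2] iF fF; rewrite (le_trans (cmod_le_ReIm _)) //= mulr_natl mulr2n.
have abs_int G : mu.-integrable D (EFin \o G) -> mu.-integrable D (EFin \o (fun x => `|G x|)).
  by move=> /integrable_abse.
rewrite lerD // (le_trans (le_normr_Rintegral _ _)) //; apply: le_Rintegral => //.
- exact: abs_int.
- by move=> x Dx; rewrite (le_trans (ler_Re _)) // fF.
- exact: abs_int.
- by move=> x Dx; rewrite (le_trans (ler_Im _)) // fF.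
Qed.

(** Without integrability the extended integral is infinite, also in the case of an indeterminate
    difference, and the real-valued integral sends both infinities to 0. *)
Lemma Rintegral_not_integrable D F : measurable D -> measurable_fun D F ->
  ~ mu.-integrable D (EFin \o F) -> \int[mu]_(x in D) F x = 0.
Proof.
move=> mD mF nF; rewrite /Rintegral.
have := integral_fin_num_abs mu mD mF.
have -> : (\int[mu]_(x in D) `|(F x)%:E| < +oo)%E = false.
  apply/negP => h; apply: nF; apply/integrableP; split => //.
  exact/measurable_EFinP.
by move=> /esym/negbT; rewrite fin_numEn => /orP[|] /eqP ->.
Qed.
End ComplexIntegral.

(** * Domination of the jump integrand by [min 1 x^2] *)

Section LevyBounds.
Context {R : realType}.
Variable k : R.
Hypothesis k_gt0 : 0 < k.
Implicit Types (x : R) (z w : R[i]).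

Let m1 x : R := Num.min 1 (x ^+ 2).

Let m1_ge0 x : 0 <= m1 x.
Proof. by rewrite /m1 le_min ler01 sqr_ge0. Qed.

Let m1_big x : x <= -1 -> m1 x = 1.
Proof. by move=> x1; apply/min_idPl; nra. Qed.

Let sqr_le_m1 x : -1 < x -> x <= k -> x ^+ 2 <= (1 + k ^+ 2) * m1 x.
Proof.
move=> x1 xk; rewrite /m1; case: (leP 1 (x ^+ 2)) => h.
- rewrite mulr1; have [x0|x0] := leP 0 x; nra.
- by rewrite ler_peMl ?sqr_ge0 // lerDl sqr_ge0.
Qed.

(** The slack [3 * r] is one [r] for the factor [expR (cmod v)] in Taylor's inequality and [2 * r]
    for the doubled exponent in [expn_fact_half]. For [x > -1] everything is bounded; for [x <= -1]
    the exponential wins, [t ^+ 2 / 2 <= expR t] giving the second constant. *)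
Lemma levy_envelope (s r : R) : 0 < r -> 3 * r < s -> exists2 C : R, 0 <= C &
  forall x, x <= k -> x ^+ 2 * expR (s * x + 3 * r * `|x|) <= C * m1 x.
Proof.
move: (k_gt0) => kp r0 rs; have sr : 0 < s - 3 * r by lra.
have E0 : 0 <= (1 + k ^+ 2) * expR ((s + 3 * r) * (k + 1)).
  by rewrite mulr_ge0 ?expR_ge0 // addr_ge0 ?sqr_ge0.
have F0 : 0 <= 2 / (s - 3 * r) ^+ 2 by rewrite divr_ge0 ?sqr_ge0.
exists ((1 + k ^+ 2) * expR ((s + 3 * r) * (k + 1)) + 2 / (s - 3 * r) ^+ 2).
  exact: addr_ge0.
move=> x xk; have [x1|x1] := ltP (-1) x.
  apply: (@le_trans _ _ (((1 + k ^+ 2) * m1 x) * expR ((s + 3 * r) * (k + 1)))).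
    rewrite ler_pM ?sqr_ge0 ?expR_ge0 ?sqr_le_m1 // ler_expR.
    have x2 : `|x| <= k + 1 by rewrite ler_norml; lra.
    have : (s + 3 * r) * `|x| <= (s + 3 * r) * (k + 1) by rewrite ler_wpM2l //; lra.
    have : s * x <= s * `|x| by rewrite ler_wpM2l ?ler_norm //; lra.
    by lra.
  by rewrite mulrAC ler_wpM2r // lerDl.
rewrite m1_big // mulr1 ler0_norm; last by lra.
pose t := (s - 3 * r) * - x; have t0 : 0 <= t by rewrite mulr_ge0 //; lra.
have -> : s * x + 3 * r * - x = - t by rewrite /t; ring.
rewrite expRN ler_wpDl // ler_pdivrMr ?expR_gt0 //.
have := expn_fact_le 2 t0; rewrite ler_pdivrMr // => h.
have -> : x ^+ 2 = t ^+ 2 / (s - 3 * r) ^+ 2 by rewrite /t; field; rewrite gt_eqF.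
rewrite [leRHS]mulrAC ler_wpM2r ?invr_ge0 ?sqr_ge0 // (le_trans h) // mulrC.
by rewrite (_ : 2`! = 2%N).
Qed.

Let expn_fact_shift (y : R) n : 0 <= y ->
  y ^+ n.+2 / n.+2`!%:R <= y ^+ 2 * (y ^+ n / n`!%:R).
Proof.
move=> y0; rewrite -addn2 addnC exprD -mulrA ler_wpM2l ?sqr_ge0 //.
rewrite ler_wpM2l ?exprn_ge0 // lef_pV2 ?posrE ?ltr0n ?fact_gt0 // ler_nat.
by rewrite !factS; nia.
Qed.

(* Taylor coefficients in [w] of [jump_integrand \1_(`]-1, +oo[) (z + w) x]. *)
Definition jump_coef z n x : R[i] := cexp (z * x%:C) * (x ^+ n / n`!%:R)%:C -
  (if n is 0 then 1 + z * x%:C * (\1_(`]-1, +oo[) x)%:C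
   else if n is 1 then (x * \1_(`]-1, +oo[) x)%:C else 0).

Definition jump_integrand (h : R -> R) z x : R[i] :=
  cexp (z * x%:C) - 1 - z * x%:C * (h x)%:C.

Let ind_gt x : -1 < x -> \1_(`]-1, +oo[) x = 1 :> R.
Proof. by move=> h; rewrite indicE mem_set //= in_itv /= h. Qed.

Let ind_le x : x <= -1 -> \1_(`]-1, +oo[) x = 0 :> R.
Proof.
by move=> h; rewrite indicE memNset //= in_itv /= andbT => /lt_geF; rewrite h.
Qed.

(** The compensator is affine in [w] and disappears into the coefficients 0 and 1, leaving
    [cexp (z x)] times the remainder of [cexp (w x)]. Two of its [M + 2] orders provide the [x ^+ 2]
    needed at small jumps, the other [M] the geometric decay. *)
Lemma jump_taylor_le z (r : R) : 0 < r -> 3 * r < complex.Re z ->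
  exists2 C : R, 0 <= C & forall x w M, x <= k -> cmod w <= r ->
  cmod (jump_integrand \1_(`]-1, +oo[) (z + w) x - \sum_(n < M.+2) w ^+ n * jump_coef z n x)
    <= C * cmod w ^+ 2 * 2^-1 ^+ M * m1 x.
Proof.
move=> r0 rz; have [C C0 HC] := levy_envelope r0 rz; exists C => // x w M xk wr.
have -> : jump_integrand \1_(`]-1, +oo[) (z + w) x - \sum_(n < M.+2) w ^+ n * jump_coef z n x
   = cexp (z * x%:C) * (cexp (w * x%:C) - exp_poly (w * x%:C) M.+2).
  have -> : exp_poly (w * x%:C) M.+2 = \sum_(n < M.+2) w ^+ n * (x ^+ n / n`!%:R)%:C.
    apply: eq_bigr => n _; rewrite exprMn -mulrA; congr (_ * _).
    by rewrite rmorphM rmorphXn /= fmorphV /= rmorph_nat.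
  under eq_bigr do rewrite mulrBr.
  rewrite sumrB [X in _ - (_ - X)](_ : _ = 1 + z * x%:C * (\1_(`]-1, +oo[) x)%:C +
     w * (x * \1_(`]-1, +oo[) x)%:C); last first.
    rewrite !big_ord_recl big1 => [|i _]; last by rewrite mulr0.
    by rewrite expr0 expr1 mul1r addr0.
  rewrite mulrBr mulr_sumr /jump_integrand mulrDl cexpD.
  have -> : (x * \1_(`]-1, +oo[) x)%:C = x%:C * (\1_(`]-1, +oo[) x)%:C :> R[i].
    exact: rmorphM.
  rewrite (eq_bigr (fun i : 'I_M.+2 =>
    cexp (z * x%:C) * (w ^+ i * (x ^+ i / i`!%:R)%:C))); last first.
    by move=> i _; rewrite mulrCA.
  by ring.
rewrite cmodM cmod_cexp cReM /= mulr0 subr0.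
apply: (@le_trans _ _ (expR (complex.Re z * x) *
    (cmod w ^+ 2 * 2^-1 ^+ M * (x ^+ 2 * expR (3 * r * `|x|))))); last first.
  apply: (@le_trans _ _ (cmod w ^+ 2 * 2^-1 ^+ M *
      (x ^+ 2 * expR (complex.Re z * x + 3 * r * `|x|)))).
    by rewrite expRD le_eqVlt; apply/orP; left; apply/eqP; ring.
  have -> : C * cmod w ^+ 2 * 2^-1 ^+ M * m1 x = cmod w ^+ 2 * 2^-1 ^+ M * (C * m1 x) by ring.
  by rewrite ler_wpM2l ?HC // mulr_ge0 ?sqr_ge0 ?exprn_ge0.
rewrite ler_wpM2l ?expR_ge0 // (le_trans (cexp_taylor _ _)) //.
rewrite cmodM cmod_real; set y := cmod w * `|x|.
have y0 : 0 <= y by rewrite mulr_ge0 ?cmod_ge0.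
have yr : y <= r * `|x| by rewrite ler_wpM2r.
apply: (@le_trans _ _ (y ^+ 2 * (y ^+ M / M`!%:R) * expR y)).
  by rewrite ler_wpM2r ?expR_ge0 // expn_fact_shift.
have -> : cmod w ^+ 2 * 2^-1 ^+ M * (x ^+ 2 * expR (3 * r * `|x|)) =
   y ^+ 2 * (2^-1 ^+ M * expR (2 * (r * `|x|))) * expR (r * `|x|).
  rewrite /y exprMn real_normK ?num_real //.
  have -> : 3 * r * `|x| = 2 * (r * `|x|) + r * `|x| by ring.
  by rewrite expRD; ring.
apply: ler_pM; rewrite ?expR_ge0 ?ler_expR //.
  by rewrite mulr_ge0 ?sqr_ge0 // divr_ge0 ?exprn_ge0.
apply: ler_wpM2l; first exact: sqr_ge0.
apply: (le_trans (expn_fact_half _ y0)); apply: ler_wpM2l; first exact: exprn_ge0.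
by rewrite ler_expR ler_wpM2l.
Qed.

(** Allows termwise integration. Near 0 the compensator makes the coefficients 0 and 1 of order
    [x ^+ 2]; the later ones have this factor by themselves, the remaining power being at most a
    multiple of [expR (r * |x|)]. Far to the left, [expR (Re z * x)] absorbs every power. *)
Lemma jump_coef_le z (r : R) n : 0 < r -> 3 * r < complex.Re z ->
  exists C : R, forall x, x <= k -> cmod (jump_coef z n x) <= C * m1 x.
Proof.
move: (k_gt0) => kp r0 rz; have z0 : 0 < complex.Re z by lra.
pose E := expR (cmod z * (k + 1)).
have expE x : -1 < x -> x <= k -> expR (cmod (z * x%:C)) <= E.
  by move=> x1 xk; rewrite ler_expR cmodM cmod_real ler_wpM2l ?cmod_ge0 // ler_norml; lra.
have zx x : complex.Re (z * x%:C) = complex.Re z * x by rewrite cReM /= mulr0 subr0.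
case: n => [|[|n]].
- pose C1 := cmod z ^+ 2 * E * (1 + k ^+ 2).
  have C10 : 0 <= C1 by rewrite !mulr_ge0 ?sqr_ge0 ?expR_ge0 ?cmod_ge0 // addr_ge0 ?sqr_ge0.
  exists (C1 + 2) => x xk; rewrite /jump_coef expr0 fact0 divr1 mulr1.
  have [x1|x1] := ltP (-1) x.
    rewrite ind_gt // mulr1.
    have := cexp_taylor (z * x%:C) 2; rewrite exp_poly2 => /le_trans; apply.
    apply: (@le_trans _ _ (cmod (z * x%:C) ^+ 2 * E)).
      rewrite ler_pM ?expR_ge0 ?expE // ?divr_ge0 ?sqr_ge0 //.
      by rewrite ler_pdivrMr // ler_peMr ?sqr_ge0 // ler1n.
    rewrite cmodM cmod_real exprMn real_normK ?num_real //.
    apply: (@le_trans _ _ (C1 * m1 x)); last by rewrite ler_wpM2r // lerDl.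
    have -> : C1 * m1 x = cmod z ^+ 2 * E * ((1 + k ^+ 2) * m1 x) by rewrite /C1; ring.
    rewrite mulrAC ler_wpM2l ?sqr_le_m1 // mulr_ge0 ?sqr_ge0 ?expR_ge0 //.
  rewrite ind_le // mulr0 addr0 m1_big // mulr1 (le_trans (ler_cmodB _ _)) //.
  rewrite cmod1 cmod_cexp zx.
  have : expR (complex.Re z * x) <= 1 by rewrite -expR0 ler_expR; nra.
  by lra.
- pose C1 := cmod z * E * (1 + k ^+ 2).
  have C10 : 0 <= C1 by rewrite !mulr_ge0 ?expR_ge0 ?cmod_ge0 // addr_ge0 ?sqr_ge0.
  exists (C1 + (complex.Re z)^-1) => x xk; rewrite /jump_coef expr1 divr1.
  have [x1|x1] := ltP (-1) x.
    rewrite ind_gt // mulr1.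
    have -> : cexp (z * x%:C) * x%:C - x%:C = (cexp (z * x%:C) - exp_poly (z * x%:C) 1) * x%:C.
      by rewrite exp_poly1; ring.
    rewrite cmodM; apply: (@le_trans _ _ ((cmod (z * x%:C) * E) * cmod x%:C)).
      rewrite ler_wpM2r ?cmod_ge0 // (le_trans (cexp_taylor _ _)) //.
      by rewrite expr1 divr1 ler_wpM2l ?cmod_ge0 ?expE.
    rewrite cmodM cmod_real.
    have -> : cmod z * `|x| * E * `|x| = cmod z * E * x ^+ 2.
      by rewrite -(real_normK (num_real x)); ring.
    apply: (@le_trans _ _ (C1 * m1 x)); last by rewrite ler_wpM2r // lerDl invr_ge0 ltW.
    have -> : C1 * m1 x = cmod z * E * ((1 + k ^+ 2) * m1 x) by rewrite /C1; ring.
    by rewrite ler_wpM2l ?sqr_le_m1 // mulr_ge0 ?cmod_ge0 ?expR_ge0.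
  rewrite ind_le // mulr0 subr0 m1_big // mulr1 cmodM cmod_real cmod_cexp zx.
  rewrite ler_wpDl // ler0_norm; last by lra.
  have t0 : 0 <= complex.Re z * - x by rewrite mulr_ge0 //; lra.
  have := expn_fact_le 1 t0; rewrite expr1 divr1 mulrN expRN => h.
  have e0 := expR_gt0 (complex.Re z * x).
  rewrite -[leRHS]mul1r ler_pdivlMr // -(divff (lt0r_neq0 e0)) -mulrA.
  by rewrite ler_wpM2l ?(ltW e0) // mulNr mulrC.
- have [C C0 HC] := levy_envelope r0 rz.
  have rn : 0 < r^-1 ^+ n by rewrite exprn_gt0 ?invr_gt0.
  exists (r^-1 ^+ n * C) => x xk; rewrite /jump_coef subr0 cmodM cmod_cexp zx cmod_real.
  apply: (@le_trans _ _ (r^-1 ^+ n *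
      (x ^+ 2 * expR (complex.Re z * x + 3 * r * `|x|)))); last first.
    by rewrite -[leRHS]mulrA ler_wpM2l ?HC // ltW.
  have -> : r^-1 ^+ n * (x ^+ 2 * expR (complex.Re z * x + 3 * r * `|x|)) =
    expR (complex.Re z * x) * (x ^+ 2 * (r^-1 ^+ n * expR (3 * r * `|x|))).
    by rewrite expRD; ring.
  rewrite ler_wpM2l ?expR_ge0 // normrM normfV normrX (ger0_norm (ler0n _ _)).
  rewrite (le_trans (expn_fact_shift n (normr_ge0 x))) // real_normK ?num_real //.
  rewrite ler_wpM2l ?sqr_ge0 //.
  have rx : 0 <= r * `|x| by rewrite mulr_ge0 // ltW.
  have -> : `|x| ^+ n / n`!%:R = r^-1 ^+ n * ((r * `|x|) ^+ n / n`!%:R).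
    by rewrite mulrA -exprMn mulKf // gt_eqF.
  rewrite ler_wpM2l ?(ltW rn) // (le_trans (expn_fact_le _ rx)) // ler_expR.
  by nra.
Qed.

End LevyBounds.

Lemma poly_approx_eq {R : realType} (F G : R[i] -> R[i]) z (r : R) :
  (forall w, cmod w <= r -> F (z + w) = G (z + w)) ->
  poly_approx F z r -> poly_approx G z r.
Proof. by move=> FG hF e /hF[p hp]; exists p => w wr; rewrite -FG // hp. Qed.

(** Complex differentiability with an explicit error, so that [derive1] at [z] is the genuine
    derivative and not a default value. *)
Definition quad_derivable {R : realType} (F : R[i] -> R[i]) z (r : R) :=
  exists (c : R[i]) (K : R), forall w, cmod w <= r ->
    cmod (F (z + w) - F z - c * w) <= K * cmod w ^+ 2.

(** * Local regularity of the Levy-Khintchine function on the quadrant *)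

Section LevyKhintchine.
Context {R : realType}.
Variables (Pi : {measure set (measurableTypeR R) -> \bar R}) (k : R).
Hypothesis (k_gt0 : 0 < k) (Pi_levy : levy_measure Pi).
Implicit Types (z w : R[i]) (h : R -> R).

Let D : set (measurableTypeR R) := `]-oo, k].

Let mD : measurable D. Proof. exact: measurable_itv. Qed.

Let m1 (x : R) : R := Num.min 1 (x ^+ 2).

Let m1_int : Pi.-integrable D (EFin \o m1).
Proof.
have [_ fin] := Pi_levy.
apply: (@integrableS _ _ _ Pi setT) => //.
have m1_ge0 x : 0 <= m1 x by rewrite /m1 le_min ler01 sqr_ge0.
apply/integrableP; split.
  apply/measurable_EFinP; apply: measurable_minr; first exact: measurable_cst.
  exact: measurable_funX.
by under eq_integral do rewrite /= ger0_norm //.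
Qed.

Let m1C_int (C : R) : Pi.-integrable D (EFin \o (fun x => C * m1 x)).
Proof. exact: integrable_Zl. Qed.

Let zx_meas z : cmeasurable D (fun x : R => z * x%:C).
Proof.
apply: cmeasurableM; first exact: cmeasurable_cst.
by apply: cmeasurable_real; exact: measurable_id.
Qed.

Lemma jump_integrand_measurable h z : measurable_fun D h ->
  cmeasurable D (jump_integrand h z).
Proof.
move=> mh; rewrite /jump_integrand; apply: cmeasurableD.
  apply: cmeasurableD; first exact: cmeasurable_cexp.
  exact: cmeasurable_cst.
by apply: cmeasurableN; apply: cmeasurableM => //; exact: cmeasurable_real.
Qed.

Let cut : R -> R := \1_(`]-1, +oo[).

Let cut_meas : measurable_fun D cut.
Proof. by apply: measurable_indic; exact: measurable_itv. Qed.

Let jump_coef_meas z n : cmeasurable D (jump_coef z n).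
Proof.
rewrite /jump_coef; apply: cmeasurableD.
  apply: cmeasurableM; first exact: cmeasurable_cexp.
  apply: cmeasurable_real; apply: measurable_funM; last exact: measurable_cst.
  by apply: measurable_funX; exact: measurable_id.
apply: cmeasurableN; case: n => [|[|n]]; last exact: cmeasurable_cst.
- apply: cmeasurableD; first exact: cmeasurable_cst.
  by apply: cmeasurableM => //; exact: cmeasurable_real.
- by apply: cmeasurable_real; apply: measurable_funM.
Qed.

Let jump_coef_int z (r : R) n : 0 < r -> 3 * r < complex.Re z ->
  cintegrable Pi D (jump_coef z n).
Proof.
move=> r0 rz; have [C HC] := @jump_coef_le _ k k_gt0 z r n r0 rz.
apply: (cintegrable_dominated mD (jump_coef_meas z n) (m1C_int C)).
by move=> x; rewrite /D /= in_itv /= => /HC.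
Qed.

Let Phi z := Cintegral Pi D (jump_integrand cut z).

Let rem z w M x := jump_integrand cut (z + w) x
  - \sum_(n < M.+2) w ^+ n * jump_coef z n x.

(** [K] depends on neither [w] nor [M]: large [M] yields [poly_approx], and [M = 0] yields
    [quad_derivable]. The integrand is integrable as the sum of the remainder and the Taylor
    polynomial. *)
Let jump_taylor z (r : R) : 0 < r -> 3 * r < complex.Re z -> exists K : R,
  forall w M, cmod w <= r -> cintegrable Pi D (jump_integrand cut (z + w)) /\
    cmod (Phi (z + w) - \sum_(n < M.+2) w ^+ n * Cintegral Pi D (jump_coef z n))
      <= K * cmod w ^+ 2 * 2^-1 ^+ M.
Proof.
move=> r0 rz; have [C C0 HC] := jump_taylor_le k_gt0 r0 rz.
exists (2 * (C * \int[Pi]_(x in D) m1 x)) => w M wr.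
have [si sE] := cintegrable_Cintegral_sum (fun n => w ^+ n) M.+2 mD
  (fun n => jump_coef_int n r0 rz).
have rem_le x : D x -> cmod (rem z w M x) <= C * cmod w ^+ 2 * 2^-1 ^+ M * m1 x.
  by rewrite /D /= in_itv /= => xk; exact: HC.
have rem_meas : cmeasurable D (rem z w M).
  apply: cmeasurableD; first exact: jump_integrand_measurable.
  apply: cmeasurableN; case: si => /integrableP[/measurable_EFinP s1 _].
  by move=> /integrableP[/measurable_EFinP s2 _]; split.
have rem_int : cintegrable Pi D (rem z w M).
  exact: cintegrable_dominated rem_meas (m1C_int _) rem_le.
have E : jump_integrand cut (z + w) =
    (fun x => rem z w M x + \sum_(n < M.+2) w ^+ n * jump_coef z n x).
  by apply/funext => x; rewrite /rem subrK.
split; first by rewrite E; exact: cintegrableD.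
rewrite /Phi E CintegralD // sE addrK.
apply: le_trans (cmod_Cintegral_le mD rem_int (m1C_int _) rem_le) _.
rewrite RintegralZl //; rewrite le_eqVlt; apply/orP; left; apply/eqP; ring.
Qed.

Let jump_int z : 0 < complex.Re z -> cintegrable Pi D (jump_integrand cut z).
Proof.
move=> z0; have [] := @jump_taylor z (complex.Re z / 4); [lra|lra|].
move=> K HK; have [|+ _] := HK 0 0%N; first by rewrite cmod0; lra.
by rewrite addr0.
Qed.

Let Phi_local z (r : R) : 0 < r -> 3 * r < complex.Re z ->
  poly_approx Phi z r /\ quad_derivable Phi z r.
Proof.
move=> r0 rz; have [K HK] := jump_taylor r0 rz; split.
- move=> e e0; have [M hM] := half_expn_small (`|K| * r ^+ 2) e0.
  exists (\poly_(n < M.+4) Cintegral Pi D (jump_coef z n)) => w wr.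
  rewrite horner_poly; under eq_bigr do rewrite mulrC.
  apply: le_trans (HK w M.+2 wr).2 _; apply: le_trans hM.
  rewrite ler_wpM2r ?exprn_ge0 //.
  apply: (@le_trans _ _ (`|K| * cmod w ^+ 2)).
    by rewrite ler_wpM2r ?sqr_ge0 // ler_norm.
  by rewrite ler_wpM2l // lerXn2r ?nnegrE ?cmod_ge0 // ltW.
- exists (Cintegral Pi D (jump_coef z 1)), K => w wr.
  have E (v : R[i]) : \sum_(n < 2) v ^+ n * Cintegral Pi D (jump_coef z n) =
      Cintegral Pi D (jump_coef z 0) + v * Cintegral Pi D (jump_coef z 1).
    by rewrite !big_ord_recl big_ord0 expr0 expr1 mul1r addr0.
  have r00 : cmod (0 : R[i]) <= r by rewrite cmod0 ltW.
  have := (HK 0 0%N r00).2; rewrite E addr0 mul0r addr0 cmod0 !expr0n /= mulr0 mul0r.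
  move=> h0; have /eqP : cmod (Phi z - Cintegral Pi D (jump_coef z 0)) = 0.
    by apply/eqP; rewrite eq_le h0 cmod_ge0.
  rewrite cmod_eq0 subr_eq0 => /eqP ->.
  have := (HK w 0%N wr).2; rewrite E expr0 mulr1.
  by rewrite -addrA -opprD [w * _]mulrC.
Qed.

Let phi h (x : R) : R := x * (cut x - h x).

Let levy_integral_form h : measurable_fun D h ->
  exists m g : R[i], forall z, Q1 z ->
    Cintegral Pi D (jump_integrand h z) = m * z + g * Phi z.
Proof.
move=> mh; have mphi : measurable_fun D (phi h).
  by apply: measurable_funM => //; exact: measurable_funB.
have E z x : jump_integrand h z x = jump_integrand cut z x + z * (phi h x)%:C.
  have -> : (phi h x)%:C = x%:C * ((cut x)%:C - (h x)%:C) :> R[i].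
    by rewrite /phi rmorphM rmorphB.
  by rewrite /jump_integrand; ring.
have [iphi|niphi] := pselect (Pi.-integrable D (EFin \o phi h)).
- have cphi : cintegrable Pi D (fun x => (phi h x)%:C).
    by split => //=; exact: integrable0.
  exists (Cintegral Pi D (fun x => (phi h x)%:C)), 1 => z [z0 _].
  rewrite (_ : jump_integrand h z = (fun x => jump_integrand cut z x + z * (phi h x)%:C)).
    rewrite CintegralD ?CintegralZ //; first by rewrite mul1r addrC mulrC.
      exact: jump_int.
    exact: cintegrableZ.
  by apply/funext => x; exact: E.
(* The two parts of [z * phi h] are [phi h] times [Re z] and [Im z], both positive on [Q1]; so
   neither part of the integrand is integrable, and one choice of [m] and [g] fits the whole
   quadrant. *)
- exists 0, 0 => z [z0 z1]; rewrite !mul0r addr0.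
  have [i1 i2] := jump_int z0; have [q1 q2] := jump_integrand_measurable z mh.
  have key (F G : R -> R) (c : R) : 0 < c -> Pi.-integrable D (EFin \o G) ->
     (forall x, F x = G x + c * phi h x) -> ~ Pi.-integrable D (EFin \o F).
    move=> c0 iG FG iF; apply: niphi.
    rewrite (_ : _ \o _ = EFin \o (fun x => c^-1 * (F x + (-1) * G x))).
      apply: integrable_Zl => //.
      rewrite (_ : _ \o _ = (EFin \o F) \+ (EFin \o (fun x => ((-1) * G x)%R)))%E //.
      by apply: integrableD => //; exact: integrable_Zl.
    apply/funext => x /=; congr EFin; rewrite FG; field.
    by rewrite gt_eqF.
  apply: complex_eqP => /=; apply: Rintegral_not_integrable => //.
  - apply: (key _ _ _ z0 i1) => x; rewrite E cReD cReM /=; ring.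
  - apply: (key _ _ _ z1 i2) => x; rewrite E cImD cImM /=; ring.
Qed.

(** [3 * r < Re z] is the room required by termwise integration; [r < Im z] keeps the disc inside
    [Q1], where [levy_integral_form] applies. *)
Lemma levy_khintchine_local (sigma mu : R) h : measurable_fun D h ->
  forall z (r : R), Q1 z -> 0 < r -> 3 * r < complex.Re z -> r < complex.Im z ->
  poly_approx (levy_khintchine sigma mu h Pi k) z r /\
  quad_derivable (levy_khintchine sigma mu h Pi k) z r.
Proof.
move=> mh z r Qz r0 rz rz'; have [m [g form]] := levy_integral_form mh.
have disc w : cmod w <= r -> Q1 (z + w).
  move=> wr; have /ler_normlP[h1 _] := ler_Re w; have /ler_normlP[h2 _] := ler_Im w.
  by split; rewrite ?cReD ?cImD; lra.
pose al := 2^-1 * (sigma ^+ 2)%:C : R[i]; pose be := mu%:C + m.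
have E w : cmod w <= r -> (al *: 'X^2 + be *: 'X).[z + w] + g * Phi (z + w) =
    levy_khintchine sigma mu h Pi k (z + w).
  move=> wr; have := form _ (disc w wr); rewrite /levy_khintchine => ->.
  by rewrite hornerD !hornerZ hornerXn hornerX /al /be; ring.
have [PA [c [K QD]]] := Phi_local r0 rz; split.
  apply: (@poly_approx_eq _ (fun u => (al *: 'X^2 + be *: 'X).[u] + g * Phi u) _ z r E).
  apply: (@poly_approxD _ (fun u => (al *: 'X^2 + be *: 'X).[u]) (fun u => g * Phi u)).
    exact: poly_approx_horner.
  exact: poly_approxZ.
exists (2 * al * z + be + g * c), (cmod al + cmod g * K) => w wr.
have E0 := E 0; rewrite addr0 in E0; rewrite -E // -E0 ?cmod0 ?(ltW r0) //.
rewrite !hornerD !hornerZ !hornerXn !hornerX.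
have -> : al * (z + w) ^+ 2 + be * (z + w) + g * Phi (z + w)
    - (al * z ^+ 2 + be * z + g * Phi z) - (2 * al * z + be + g * c) * w =
  al * w ^+ 2 + g * (Phi (z + w) - Phi z - c * w) by ring.
rewrite (le_trans (ler_cmodD _ _)) // mulrDl (cmodM al) (cmodM g) cmodX.
rewrite -(mulrA (cmod g)) lerD //.
by rewrite ler_wpM2l ?cmod_ge0 // QD.
Qed.

End LevyKhintchine.

Lemma laplace_exponent_local {R : realType} {d : measure_display} {T : measurableType d}
  (P : probability T R) (X : R -> {RV P >-> R})
  (Pi : {measure set (measurableTypeR R) -> \bar R}) (k : R) (psi : R[i] -> R[i]) :
  0 < k -> laplace_exponent X Pi k psi ->
  forall z (r : R), Q1 z -> 0 < r -> 3 * r < complex.Re z -> r < complex.Im z ->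
  poly_approx psi z r /\ quad_derivable psi z r.
Proof.
move=> k0 [sigma [mu [h [_ Pi_levy cut psiE _]]]] z r Qz r0 rz rz'.
have mh : measurable_fun (`]-oo, k]%classic : set (measurableTypeR R)) h.
  case: cut => [[_ ->]|[_ [->|[_ ->]]]]; try exact: measurable_cst.
  by apply: measurable_indic; exact: measurable_itv.
have [PA [c [K QD]]] := levy_khintchine_local k0 Pi_levy sigma mu mh Qz r0 rz rz'.
have E w : cmod w <= r -> levy_khintchine sigma mu h Pi k (z + w) = psi (z + w).
  move=> wr; rewrite psiE // cReD; have /ler_normlP[h1 _] := ler_Re w.
  by lra.
split; first exact: poly_approx_eq PA.
exists c, K => w wr; have E0 := E 0; rewrite addr0 in E0.
by rewrite -E // -E0 ?cmod0 ?(ltW r0) // QD.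
Qed.

(** * Newton's iteration and the limit function [1 - exp (k w)] *)

Section Newton.
Context {R : realType}.
Implicit Types (x y C : R) (z w : R[i]).

Lemma le_half_expn x y C : (forall n, x <= y + C * 2^-1 ^+ n) -> x <= y.
Proof.
move=> h; rewrite leNgt; apply/negP => yx.
have [M hM] := @half_expn_small _ C ((x - y) / 2) ltac:(lra).
by have := h M.+2; lra.
Qed.

(** [e n] is the sum of all increments still to come, so the intervals of centre [v n] and radius
    [e n] are nested; the limit is the supremum of their left ends. *)
Lemma geometric_cvg (v : nat -> R) C :
  (forall n, `|v n.+1 - v n| <= C * 2^-1 ^+ n) ->
  exists l, forall n, `|v n - l| <= 2 * C * 2^-1 ^+ n.
Proof.
move=> h; pose e n : R := 2 * C * 2^-1 ^+ n.
have e0 n : 0 <= e n.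
  by rewrite /e -mulrA mulr_ge0 // (le_trans _ (h n)).
have eS n : e n.+1 = C * 2^-1 ^+ n by rewrite /e exprS; field.
have eS2 n : e n = 2 * (C * 2^-1 ^+ n) by rewrite /e mulrA.
have up n m : (n <= m)%N -> v n - e n <= v m - e m /\ v m + e m <= v n + e n.
  elim: m => [|m IH]; first by rewrite leqn0 => /eqP ->.
  rewrite leq_eqVlt => /orP[/eqP -> //|]; rewrite ltnS => /IH[h1 h2].
  have /ler_normlP[h3 h4] := h m.
  by rewrite eS; rewrite (eS2 m) in h1 h2; lra.
have cross n m : v n - e n <= v m + e m.
  have [h1 _] := up _ _ (leq_maxl n m); have [_ h2] := up _ _ (leq_maxr n m).
  by have := e0 (maxn n m); lra.
pose S := range (fun n => v n - e n).
have Sub m : ubound S (v m + e m) by move=> _ [n _ <-]; exact: cross.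
exists (sup S) => n; rewrite -/(e n) ler_norml.
have h1 : v n - e n <= sup S.
  by apply: ub_le_sup; [exists (v 0%N + e 0%N)|exists n].
have h2 : sup S <= v n + e n.
  by apply: ge_sup => //; exists (v 0%N - e 0%N), 0%N.
by lra.
Qed.

Lemma cgeometric_cvg (u : nat -> R[i]) C :
  (forall n, cmod (u n.+1 - u n) <= C * 2^-1 ^+ n) ->
  exists l, forall n, cmod (u n - l) <= 4 * C * 2^-1 ^+ n.
Proof.
move=> h.
have [|a ha] := @geometric_cvg (fun n => complex.Re (u n)) C.
  by move=> n; rewrite (le_trans _ (h n)) // -cReN -cReD ler_Re.
have [|b hb] := @geometric_cvg (fun n => complex.Im (u n)) C.
  by move=> n; rewrite (le_trans _ (h n)) // -cImN -cImD ler_Im.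
exists (a +i* b) => n; rewrite (le_trans (cmod_le_ReIm _)) //.
rewrite cReD cReN cImD cImN /=; have := ha n; have := hb n; lra.
Qed.

(* Simplified Newton iteration [w + G w / kp], a contraction when [G] is close
   to [- kp * w]. *)
Lemma newton_zero (G : R[i] -> R[i]) (kp d : R) : 0 < kp -> 0 < d ->
  (forall w1 w2, cmod w1 <= d -> cmod w2 <= d ->
     cmod (G w1 - G w2 + kp%:C * (w1 - w2)) <= kp / 2 * cmod (w1 - w2)) ->
  cmod (G 0) <= kp * d / 2 -> exists w, cmod w <= d /\ G w = 0.
Proof.
move=> k0 d0 hG G0; have kC0 : kp%:C != 0 :> R[i].
  by rewrite -cmod_eq0 cmod_real normr_eq0 gt_eqF.
have cmodk : cmod kp%:C = kp by rewrite cmod_real gtr0_norm.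
pose Tn w := w + G w / kp%:C.
have TB w1 w2 : cmod w1 <= d -> cmod w2 <= d ->
    cmod (Tn w1 - Tn w2) <= 2^-1 * cmod (w1 - w2).
  move=> h1 h2; rewrite -(ler_pM2l k0) -{1}cmodk -cmodM mulrA.
  have -> : kp%:C * (Tn w1 - Tn w2) = G w1 - G w2 + kp%:C * (w1 - w2).
    by rewrite /Tn; field.
  exact: hG.
have Td w : cmod w <= d -> cmod (Tn w) <= d.
  move=> wd; have := TB w 0 wd; rewrite cmod0 (ltW d0) subr0 => /(_ isT) h1.
  have h2 : cmod (Tn 0) <= d / 2.
    rewrite /Tn add0r cmodM cmodV cmodk ler_pdivrMr //; lra.
  have := ler_cmod_dist (Tn w) (Tn 0); lra.
pose u n := iter n Tn 0.
have ud n : cmod (u n) <= d.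
  by elim: n => [|n IH]; [rewrite (_ : u 0%N = 0) // cmod0 ltW|exact: Td].
have uS n : cmod (u n.+1 - u n) <= d * 2^-1 ^+ n.
  elim: n => [|n IH].
    by rewrite expr0 mulr1 (_ : u 0%N = 0) // subr0 ud.
  rewrite (le_trans (TB _ _ (ud n.+1) (ud n))) // exprS.
  by rewrite mulrCA ler_wpM2l.
have [l hl] := cgeometric_cvg uS.
have ld : cmod l <= d.
  apply: (@le_half_expn _ _ (4 * d)) => n.
  by have := ler_cmod_dist l (u n); have := hl n; have := ud n; rewrite cmodC; lra.
exists l; split => //; apply/eqP; rewrite -cmod_eq0 eq_le cmod_ge0 andbT.
(* In units of [kp * d * 2^-1 ^+ n]: the residual at [u n] counts 1, and moving from [u n] to [l],
   at distance 4, counts 2 + 4; 8 rounds up this 7. *)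
apply: (@le_half_expn _ _ (8 * kp * d)) => n; rewrite add0r.
have h1 : cmod (G (u n)) <= kp * (d * 2^-1 ^+ n).
  have -> : G (u n) = kp%:C * (u n.+1 - u n) by rewrite /u /= /Tn; field.
  by rewrite cmodM cmodk ler_wpM2l // ltW.
have h2 : cmod (G l - G (u n)) <= kp * (6 * d * 2^-1 ^+ n).
  have -> : G l - G (u n) = (G l - G (u n) + kp%:C * (l - u n)) - kp%:C * (l - u n) by ring.
  rewrite (le_trans (ler_cmodB _ _)) // cmodM cmodk.
  have := hG l (u n) ld (ud n); have := hl n; rewrite cmodC => h3 h4.
  have : kp * cmod (l - u n) <= kp * (4 * d * 2^-1 ^+ n) by rewrite ler_wpM2l // ltW.
  by lra.
have : cmod (G l) <= cmod (G l - G (u n)) + cmod (G (u n)).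
  by rewrite -{1}[G l](subrK (G (u n))) ler_cmodD.
have : 0 <= kp * d * 2^-1 ^+ n by rewrite !mulr_ge0 ?exprn_ge0 // ltW.
by lra.
Qed.

(** The defect splits as [cexp u * (cexp v - 1 - v) + (cexp u - 1) * v]. With [cmod u <= 1 / 64] and
    [cmod v <= 1 / 32] the two terms are at most [9 / 64] and [4 / 64] of [cmod v]. The bound
    [d <= 1 / 4] keeps differences of two points in the half disc of radius [1 / 2], as Cauchy's
    estimate on the unit disc requires. *)
Lemma cexp_lipschitz (kp : R) : 0 < kp -> exists2 d : R, 0 < d <= 4^-1 &
  forall w1 w2, cmod w1 <= d -> cmod w2 <= d ->
  cmod (cexp (kp%:C * w1) - cexp (kp%:C * w2) - kp%:C * (w1 - w2)) <= kp / 4 * cmod (w1 - w2).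
Proof.
move=> k0.
pose d : R := Num.min 4^-1 ((64 * (kp + 1))^-1).
have kp1 : 0 < 64 * (kp + 1) by lra.
have d0 : 0 < d by rewrite /d lt_min !invr_gt0 kp1 andbT.
have d1 : d <= 4^-1 by rewrite ge_min lexx.
have d2 : d * (64 * (kp + 1)) <= 1.
  by rewrite -ler_pdivlMr // mul1r ge_min lexx orbT.
exists d; first by rewrite d0.
move=> w1 w2 h1 h2.
have cmodk : cmod kp%:C = kp by rewrite cmod_real gtr0_norm.
have kd : kp * d <= 64^-1 by nra.
have km w : cmod w <= d -> cmod (kp%:C * w) <= 64^-1.
  move=> wd; rewrite cmodM cmodk; have := cmod_ge0 w; nra.
have w12 : cmod (w1 - w2) <= 2 * d by rewrite (le_trans (ler_cmodB _ _)) //; lra.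
set D := w1 - w2 in w12 *; set v := kp%:C * D.
have vk : cmod v = kp * cmod D by rewrite cmodM cmodk.
have v1 : cmod v <= 32^-1 by rewrite vk; have := cmod_ge0 D; nra.
set u := kp%:C * w2; have u1 : cmod u <= 64^-1 by exact: km.
have -> : kp%:C * w1 = u + v by rewrite /u /v /D; ring.
have -> : cexp (u + v) - cexp u - v =
  cexp u * (cexp v - (1 + v)) + (cexp u - 1) * v by rewrite cexpD; ring.
have T2 : cmod (cexp v - (1 + v)) <= 4 * cmod v ^+ 2.
  have := cexp_taylor v 2; rewrite exp_poly2 => /le_trans; apply.
  rewrite mulrC ler_pM ?expR_ge0 ?expR_le4 ?divr_ge0 ?sqr_ge0 //; first by lra.
  by rewrite ler_pdivrMr // ler_peMr ?sqr_ge0 // ler1n.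
have T1 : cmod (cexp u - 1) <= 4 * cmod u by apply: cexp_sub1_le => //; lra.
have E1 : cmod (cexp u) <= 9 / 8.
  have := ler_cmod_dist (cexp u) 1; rewrite cmod1; lra.
rewrite (le_trans (ler_cmodD _ _)) // (cmodM (cexp u)) (cmodM _ v).
have v0 := cmod_ge0 v; have u0 := cmod_ge0 u.
have F1 : cmod (cexp u) * cmod (cexp v - (1 + v)) <= 9 / 8 * (4 * cmod v ^+ 2).
  by rewrite ler_pM ?cmod_ge0.
have F2 : cmod (cexp u - 1) * cmod v <= 16^-1 * cmod v.
  rewrite ler_wpM2r //; lra.
have F3 : cmod v ^+ 2 <= 32^-1 * cmod v by rewrite expr2 ler_wpM2r.
have -> : kp / 4 * cmod D = cmod v / 4 by rewrite vk; ring.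
lra.
Qed.

End Newton.

(** * Growth of logarithms, and the principal logarithm near the imaginary axis *)

Section Growth.
Context {R : realType}.
Implicit Types (t c C e : R) (z w : R[i]).

Lemma near_cmod (Q : R -> Prop) : (\forall t \near +oo, Q t) ->
  \forall z \near @Q1_infty R, Q (cmod z).
Proof. by move=> [M [_ HM]]; exists M => z _ zM; exact: HM. Qed.

Lemma near_Q1 : \forall z \near @Q1_infty R, Q1 z.
Proof. by exists 0. Qed.

Lemma near_grid (k : R) (Q : R -> Prop) : 0 < k -> (\forall t \near +oo, Q t) ->
  \forall n \near \oo, Q (2 * n%:R * pi / k).
Proof.
move=> k0 [M [_ HM]]; have c0 : 0 < 2 * pi / k by rewrite divr_gt0 ?mulr_gt0 ?pi_gt0.
near=> n; apply: HM.
have -> : 2 * n%:R * pi / k = n%:R * (2 * pi / k) by ring.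
rewrite -ltr_pdivrMr //; near: n; exact: nbhs_infty_gtr.
Unshelve. all: by end_near. Qed.

Lemma ln_le_linear C c e : 0 < e -> \forall t \near +oo, C + c * ln t <= e * t.
Proof.
move=> e0; pose c1 := `|c| + 1; have c10 : 0 < c1 by rewrite ltr_wpDl.
(* Applying [ln y < y] to [y = m * t] gives [ln t] slope [m], so that [c1 * ln t] uses half of [e]
   and the constants use the other half. *)
pose m := e / (2 * c1); have m0 : 0 < m by rewrite divr_gt0 // mulr_gt0.
near=> t.
have t1 : 1 <= t by near: t; by apply: nbhs_pinfty_ge; exact: num_real.
have t0 : 0 < t by lra.
have h1 : C - c1 * ln m <= e / 2 * t.
  rewrite -ler_pdivrMl; last by lra.
  by near: t; by apply: nbhs_pinfty_ge; exact: num_real.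
have h2 : ln t <= m * t - ln m.
  have := ltW (ln_sublinear (mulr_gt0 m0 t0)).
  by rewrite lnM ?posrE //; lra.
have h3 : c * ln t <= c1 * ln t.
  by rewrite ler_wpM2r ?ln_ge0 // /c1 (le_trans (ler_norm c)) // lerDl.
have h4 : c1 * ln t <= c1 * (m * t - ln m) by rewrite ler_wpM2l // ltW.
have h5 : c1 * (m * t) = e / 2 * t by rewrite /m; field; rewrite gt_eqF.
by lra.
Unshelve. all: by end_near. Qed.

Lemma ln_ge_near C : \forall t \near +oo, C <= ln t.
Proof.
near=> t; have h : expR C <= t by near: t; by apply: nbhs_pinfty_ge; exact: num_real.
by rewrite -[leLHS]expRK ler_ln ?posrE ?expR_gt0 // (lt_le_trans (expR_gt0 C)).
Unshelve. all: by end_near. Qed.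

Lemma expR_ln_ge_near (b C : R) : 0 < b -> \forall t \near +oo, C <= expR (b * ln t).
Proof.
move=> b0; near=> t; have h : C / b <= ln t by near: t; exact: ln_ge_near.
rewrite (le_trans _ (expR_ge1Dx _)) //.
by move: h; rewrite ler_pdivrMr // mulrC; lra.
Unshelve. all: by end_near. Qed.

Lemma acos_near0 e : 0 < e -> exists2 d : R, 0 < d &
  forall y, `|y| < d -> `|acos y - pi / 2| < e.
Proof.
move=> e0; have := @continuous_acos R 0; rewrite ltrN10 ltr01 => /(_ isT).
move=> /cvgrPdist_lt/(_ e e0); rewrite acos0 => -[d /= d0 hd]; exists d => // y yd.
by rewrite distrC; apply: hd; rewrite /= sub0r normrN.
Qed.

Lemma clog_near e : 0 < e -> exists2 eta : R, 0 < eta &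
  forall z t, 0 < t -> `|complex.Re z| <= eta * t -> `|complex.Im z - t| <= eta * t ->
  cmod (clog z - (ln t +i* (pi / 2))) <= e.
Proof.
move=> e0; have e2 : 0 < e / 2 by lra.
have [d d0 hd] := acos_near0 e2.
(* [1 / 4] keeps the imaginary part positive, [e / 4] gives [ln (1 + 2 * eta) <= e / 2] for the
   modulus, and [d / 4] brings the cosine of the argument below [d]. *)
pose eta := Num.min (1 / 4) (Num.min (e / 4) (d / 4)).
have [h1 h2 h3] : [/\ eta <= 1 / 4, eta <= e / 4 & eta <= d / 4].
  by rewrite /eta !ge_min !lexx !orbT.
have eta0 : 0 < eta by rewrite !lt_min; lra.
exists eta => // z t t0 hr hi.
have /ler_normlP[hi1 hi2] := hi.
have q0 : 0 <= (1 / 4 - eta) * t by apply: mulr_ge0; lra.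
have etat : 0 < eta * t by rewrite mulr_gt0.
have im0 : 0 < complex.Im z by lra.
have zlow : (1 - eta) * t <= cmod z.
  by rewrite (le_trans _ (ler_Im z)) // ger0_norm; lra.
have zup : cmod z <= (1 + 2 * eta) * t.
  by rewrite (le_trans (cmod_le_ReIm z)) // (gtr0_norm im0); lra.
have z0 : 0 < cmod z by lra.
have lnb : `|ln (cmod z) - ln t| <= e / 2.
  rewrite -ln_div ?posrE // ler_norml; apply/andP; split.
  - rewrite lerNl -lnV ?posrE ?divr_gt0 // invf_div.
    have h : t / cmod z <= 1 + 2 * eta.
      rewrite ler_pdivrMr //.
      have : (1 + 2 * eta) * ((1 - eta) * t) <= (1 + 2 * eta) * cmod z.
        by rewrite ler_wpM2l //; lra.
      have : 0 <= eta * (1 - 2 * eta) * t by rewrite !mulr_ge0 ?(ltW t0) ?(ltW eta0) //; lra.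
      by lra.
    rewrite (@le_trans _ _ (ln (1 + 2 * eta))) //.
      by rewrite ler_ln ?posrE ?divr_gt0 //; lra.
    by rewrite (le_trans (le_ln1Dx _)) //; lra.
  - have h : cmod z / t <= 1 + 2 * eta by rewrite ler_pdivrMr.
    rewrite (@le_trans _ _ (ln (1 + 2 * eta))) //.
      by rewrite ler_ln ?posrE ?divr_gt0 //; lra.
    by rewrite (le_trans (le_ln1Dx _)) //; lra.
have argb : `|carg z - pi / 2| <= e / 2.
  rewrite /carg (ltW im0); apply/ltW/hd.
  rewrite normrM normfV (gtr0_norm z0) ltr_pdivrMr //.
  by nra.
rewrite (le_trans (cmod_le_ReIm _)) // cReD cReN cImD cImN /=.
by lra.
Qed.

Lemma carg_le_pi z : z != 0 -> `|carg z| <= pi.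
Proof.
move=> z0; have zp : 0 < cmod z by rewrite cmod_gt0.
have : `|complex.Re z / cmod z| <= 1.
  by rewrite normrM normfV (ger0_norm (cmod_ge0 z)) ler_pdivrMr // mul1r ler_Re.
rewrite ler_norml => b2; rewrite /carg; case: ifP => _; rewrite ?normrN ger0_norm;
  by rewrite ?acos_ge0 ?acos_lepi.
Qed.

End Growth.

(** * Behaviour of [psi - q] near the predicted points, and location of large zeros *)

Section Asymptotics.
Context {R : realType}.
Variables (k a b q : R) (A B : R[i]) (psi : R[i] -> R[i]).
Hypotheses (k_gt0 : 0 < k) (a_ge0 : 0 <= a) (b_gt0 : 0 < b).
Hypotheses (A_neq0 : A != 0) (B_neq0 : B != 0).
Implicit Types (z w : R[i]) (e C : R) (n : nat).

Definition predicted n : R[i] :=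
  (k^-1 * (ln (cmod (B / A)) + (a + b) * ln (2 * n%:R * pi / k))) +i*
  (k^-1 * (carg (B / A) + (2^-1 * (a + b) + 2 * n%:R + 1) * pi)).

Let t n : R := 2 * n%:R * pi / k.

(* Leading order of [clog] near [predicted n]. *)
Let lam n : R[i] := ln (t n) +i* (pi / 2).

Let BA_neq0 : B / A != 0. Proof. by rewrite mulf_neq0 ?invr_neq0. Qed.

(** Origin of the prediction: it solves [exp (k z - (a + b) log z) = - B / A] with [log z] replaced
    by [lam n] and the logarithm of -1 taken on the branch [(2 n + 1) pi i]. The argument [pi / 2]
    in [lam n] explains the shift by [(a + b) / 2]. *)
Let k_predicted n : k%:C * predicted n =
  clog (B / A) + (a + b)%:C * lam n + 0 +i* ((2 * n%:R + 1) * pi).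
Proof.
have kn0 : k != 0 by rewrite gt_eqF.
rewrite /clog /lam /t /predicted; set x := ln (cmod (B / A)); set y := carg (B / A).
set l := ln _.
by apply: complex_eqP; rewrite !(cReD, cImD, cReZ, cImZ) /=; field.
Qed.

Let cexp_odd_pi (n : int) : cexp (0 +i* ((2 * n%:~R + 1) * pi)) = -1 :> R[i].
Proof.
rewrite -cexp_pi -(cexp_period (0 +i* pi) n); congr cexp.
by apply: complex_eqP; rewrite !(cReD, cImD) /= ?addr0 //; ring.
Qed.

Let grid_pos : \forall n \near \oo, 0 < t n.
Proof.
apply: (near_grid (Q := fun t => 0 < t)) => //.
by apply: nbhs_pinfty_gt; exact: num_real.
Qed.

(** The real part grows like [ln (t n)] and the imaginary part differs from [t n] by a constant.
    Radius 2 leaves room for unit discs centred at points of the Newton disc. *)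
Lemma predicted_near e C : 0 < e -> \forall n \near \oo, forall w, cmod w <= 2 ->
  [/\ `|complex.Re (predicted n + w)| <= e * t n,
      `|complex.Im (predicted n + w) - t n| <= e * t n,
      C <= complex.Re (predicted n + w) & C <= complex.Im (predicted n + w)].
Proof.
move=> e0; have k0 := k_gt0; have a0 := a_ge0; have b0 := b_gt0.
have s0 : 0 < a + b by lra.
set c0 := ln (cmod (B / A)); pose c1 := k^-1 * (carg (B / A) + (2^-1 * (a + b) + 1) * pi).
near=> n => w w2.
have h1 : `|k^-1 * c0| + 2 + (k^-1 * (a + b)) * ln (t n) <= e * t n.
  near: n; apply: (near_grid (Q := fun t => _ + _ * ln t <= e * t)) => //.
  exact: ln_le_linear.
have h2 : 0 <= ln (t n).
  by near: n; apply: (near_grid (Q := fun t => _ <= ln t)) => //; exact: ln_ge_near.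
(* The zero coefficient puts a plain constant into the shape of [ln_le_linear]. *)
have h3 : `|c1| + 2 + 0 * ln (t n) <= e * t n.
  near: n; apply: (near_grid (Q := fun t => _ + _ * ln t <= e * t)) => //.
  exact: ln_le_linear.
have h4 : (k * (C + 2) - c0) / (a + b) <= ln (t n).
  by near: n; apply: (near_grid (Q := fun t => _ <= ln t)) => //; exact: ln_ge_near.
have h5 : C + 2 - c1 <= t n.
  near: n; apply: (near_grid (Q := fun t => _ <= t)) => //.
  by apply: nbhs_pinfty_ge; exact: num_real.
have Re_p : complex.Re (predicted n) = k^-1 * c0 + k^-1 * (a + b) * ln (t n).
  by rewrite /= -/c0 /t; ring.
have Im_p : complex.Im (predicted n) = t n + c1.
  by rewrite /= /t /c1; field; rewrite gt_eqF.
rewrite cReD cImD Re_p Im_p.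
have /ler_normlP[r1 r2] := le_trans (ler_Re w) w2.
have /ler_normlP[i1 i2] := le_trans (ler_Im w) w2.
have h6 : 0 <= k^-1 * (a + b) * ln (t n).
  by rewrite !mulr_ge0 ?invr_ge0 // ltW.
have c0n : - `|k^-1 * c0| <= k^-1 * c0 <= `|k^-1 * c0| by rewrite lerNnormlW // ler_norm.
have c1n : - `|c1| <= c1 <= `|c1| by rewrite lerNnormlW // ler_norm.
split.
- by rewrite ler_norml; lra.
- by rewrite ler_norml; lra.
- move: h4; rewrite ler_pdivrMr // => h4.
  have : k^-1 * (k * (C + 2)) <= k^-1 * (ln (t n) * (a + b) + c0).
    by rewrite ler_wpM2l ?invr_ge0 ?(ltW k0) //; lra.
  by rewrite mulKf ?gt_eqF //; lra.
- by lra.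
Unshelve. all: by end_near. Qed.

Let clog_predicted e : 0 < e -> \forall n \near \oo, forall w, cmod w <= 2 ->
  cmod (clog (predicted n + w) - lam n) <= e.
Proof.
move=> e0; have [eta eta0 heta] := clog_near e0.
near=> n => w w2; have tp : 0 < t n by near: n; exact: grid_pos.
have [h1 h2 _ _] : [/\ `|complex.Re (predicted n + w)| <= eta * t n,
    `|complex.Im (predicted n + w) - t n| <= eta * t n,
    0 <= complex.Re (predicted n + w) & 0 <= complex.Im (predicted n + w)].
  by move: w w2; near: n; exact: predicted_near.
exact: heta.
Unshelve. all: by end_near. Qed.

Hypothesis asym : forall e, 0 < e -> \forall z \near @Q1_infty R,
  cmod (psi z - (A * cexp (k%:C * z) * cpow z (- a)%:C + B * cpow z b%:C)) <=
  e * (cmod (cexp (k%:C * z) * cpow z (- a)%:C) + cmod (cpow z b%:C)).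

Definition scaling n : R[i] := B * cexp (b%:C * lam n).

Lemma scaling_neq0 n : scaling n != 0.
Proof. by rewrite mulf_neq0 // cexp_neq0. Qed.

(* [psi - q] near [predicted n], normalised so as to tend to [1 - exp (k w)]. *)
Definition scaled n w : R[i] := (psi (predicted n + w) - q%:C) / scaling n.

Let asym_predicted e : 0 < e -> \forall n \near \oo, forall w, cmod w <= 2 ->
  let z := predicted n + w in
  cmod (psi z - (A * cexp (k%:C * z) * cpow z (- a)%:C + B * cpow z b%:C)) <=
  e * (cmod (cexp (k%:C * z) * cpow z (- a)%:C) + cmod (cpow z b%:C)).
Proof.
move=> /asym[M HM]; near=> n => w w2 /=.
(* [M] may be negative; the absolute value makes the point lie in [Q1] as well as beyond [M]. *)
have [_ _ h1 h2] : [/\ `|complex.Re (predicted n + w)| <= 1 * t n,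
    `|complex.Im (predicted n + w) - t n| <= 1 * t n,
    `|M| + 1 <= complex.Re (predicted n + w) & `|M| + 1 <= complex.Im (predicted n + w)].
  by move: w w2; near: n; exact: predicted_near.
have M0 : 0 <= `|M| by [].
apply: HM; first by split; lra.
have := ler_norm M; have := ler_Re (predicted n + w); rewrite ler_norml; lra.
Unshelve. all: by end_near. Qed.

(** With [clog z = lam n + L], the choice of [predicted n] turns the main terms into [B * S * (cexp
    (b L) - cexp (k w) * cexp (- a L))], and [L] tends to 0. The smallness of [L], the Landau terms
    and [q] each use a third of [e]. *)
Lemma scaled_near e : 0 < e -> \forall n \near \oo, forall w, cmod w <= 2 ->
  cmod (scaled n w - (1 - cexp (k%:C * w))) <= e.
Proof.
move=> e0; have k0 := k_gt0; have a0 := a_ge0; have b0 := b_gt0.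
have A0 : 0 < cmod A by rewrite cmod_gt0.
have B0 : 0 < cmod B by rewrite cmod_gt0.
pose E := expR (k * 2); have E0 : 0 < E := expR_gt0 _.
(* [de] bounds the error on the logarithm, [ep] that of the Landau terms *)
pose de := Num.min (1 / (a + b + 1)) (e / 3 / (4 * (E * a + b) + 1)).
have Ea : 0 <= E * a by rewrite mulr_ge0 // ltW.
have den0 : 0 < 4 * (E * a + b) + 1 by lra.
have de0 : 0 < de by rewrite lt_min !divr_gt0 //; lra.
have de1 : de * (a + b + 1) <= 1.
  by rewrite -ler_pdivlMr; [rewrite ge_min lexx|lra].
have de2 : de * (4 * (E * a + b) + 1) <= e / 3.
  by rewrite -ler_pdivlMr // ge_min lexx orbT.
(* Bounds the sum of the moduli of [X] and [Y] divided by that of [scaling n]; the 5 is [1 + 4],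
   from [cexp_sub1_le] with arguments of modulus at most 1. *)
pose K := 5 * E / cmod A + 5 / cmod B.
have K0 : 0 < K by rewrite addr_gt0 // divr_gt0 // mulr_gt0.
pose ep := e / 3 / K; have ep0 : 0 < ep by rewrite !divr_gt0.
near=> n => w w2.
have hL : cmod (clog (predicted n + w) - lam n) <= de.
  by move: w w2; near: n; exact: clog_predicted.
pose z := predicted n + w.
have hP : cmod (psi z - (A * cexp (k%:C * z) * cpow z (- a)%:C + B * cpow z b%:C)) <=
  ep * (cmod (cexp (k%:C * z) * cpow z (- a)%:C) + cmod (cpow z b%:C)).
  by rewrite /z; move: w w2 {hL z}; near: n; exact: asym_predicted.
have hq : `|q| / cmod B / (e / 3) <= expR (b * ln (t n)).
  near: n; apply: (near_grid (Q := fun t => _ <= expR (b * ln t))) => //.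
  exact: expR_ln_ge_near.
move: hP; set X := cexp (k%:C * z) * _; set Y := cpow z b%:C => hP.
rewrite -/z in hL; set L := clog z - lam n in hL.
have clogz : clog z = lam n + L by rewrite /L addrC subrK.
pose S := cexp (b%:C * lam n); have S0 : S != 0 := cexp_neq0 _.
have XE : X = - (B / A) * S * cexp (k%:C * w) * cexp (- a%:C * L).
  rewrite /X cpowE -cexpD clogz /z mulrDr k_predicted.
  have -> : clog (B / A) + (a + b)%:C * lam n + 0 +i* ((2 * n%:R + 1) * pi) + k%:C * w
    + (- a)%:C * (lam n + L) = clog (B / A) + 0 +i* ((2 * (n%:Z)%:~R + 1) * pi) + b%:C * lam n
    + k%:C * w + - a%:C * L.
    by rewrite rmorphD rmorphN /= -pmulrn; ring.
  by rewrite !cexpD clogK // cexp_odd_pi; rewrite /S; ring.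
have YE : Y = S * cexp (b%:C * L) by rewrite /Y cpowE clogz mulrDr cexpD.
have cmodkw : cmod (cexp (k%:C * w)) <= E.
  rewrite cmod_cexp cReZ ler_expR ler_pM2l // (le_trans (ler_norm _)) //.
  by rewrite (le_trans (ler_Re _)).
have ade1 : a * de <= 1 by nra.
have bde1 : b * de <= 1 by nra.
have aL : cmod (cexp (- a%:C * L) - 1) <= 4 * (a * de).
  apply: cexp_sub1_le => //; rewrite cmodM cmodN cmod_real ger0_norm //.
  by rewrite ler_wpM2l.
have bL : cmod (cexp (b%:C * L) - 1) <= 4 * (b * de).
  apply: cexp_sub1_le => //; rewrite cmodM cmod_real gtr0_norm //.
  by rewrite ler_wpM2l // ltW.
have aL5 : cmod (cexp (- a%:C * L)) <= 5.
  by have := ler_cmod_dist (cexp (- a%:C * L)) 1; rewrite cmod1; lra.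
have bL5 : cmod (cexp (b%:C * L)) <= 5.
  by have := ler_cmod_dist (cexp (b%:C * L)) 1; rewrite cmod1; lra.
set r := psi z - _ in hP.
have -> : scaled n w - (1 - cexp (k%:C * w)) =
  - cexp (k%:C * w) * (cexp (- a%:C * L) - 1) + (cexp (b%:C * L) - 1)
   + (r / scaling n - q%:C / scaling n).
  have -> : r / scaling n = psi z / scaling n + cexp (k%:C * w) * cexp (- a%:C * L)
      - cexp (b%:C * L).
    rewrite /r -mulrA -/X XE YE /scaling -/S; field.
    by rewrite A_neq0 B_neq0 S0.
  by rewrite /scaled -/z; ring.
have cmodS : cmod S = expR (b * ln (t n)) by rewrite cmod_cexp cReZ.
have Sp : 0 < cmod S by rewrite cmod_gt0.
have cmods : cmod (scaling n) = cmod B * cmod S by rewrite cmodM.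
have sp : 0 < cmod (scaling n) by rewrite cmods mulr_gt0.
have b1 : cmod (- cexp (k%:C * w) * (cexp (- a%:C * L) - 1)) <= E * (4 * (a * de)).
  by rewrite cmodM cmodN ler_pM ?cmod_ge0.
have b2 : cmod (r / scaling n) <= e / 3.
  rewrite cmodM cmodV ler_pdivrMr // (le_trans hP) //.
  have -> : e / 3 = ep * K by rewrite /ep divfK // gt_eqF.
  rewrite -(mulrA ep); apply: ler_wpM2l; first exact: ltW.
  rewrite cmods XE YE !cmodM cmodN cmodM cmodV mulrDl lerD //.
  - have -> : 5 * E / cmod A * (cmod B * cmod S) = cmod B / cmod A * cmod S * (E * 5) by ring.
    rewrite -[leLHS]mulrA; apply: ler_wpM2l; last by rewrite ler_pM ?cmod_ge0.
    by rewrite !mulr_ge0 ?invr_ge0 ?cmod_ge0.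
  - have -> : 5 / cmod B * (cmod B * cmod S) = cmod S * 5 by field; rewrite gt_eqF.
    by rewrite ler_wpM2l // ltW.
have b3 : cmod (q%:C / scaling n) <= e / 3.
  rewrite cmodM cmodV cmod_real ler_pdivrMr // cmods cmodS.
  move: hq; rewrite ler_pdivrMr; last by lra.
  by rewrite ler_pdivrMr //; lra.
rewrite (le_trans (ler_cmodD _ _)) //.
have := ler_cmodB (r / scaling n) (q%:C / scaling n).
have := ler_cmodD (- cexp (k%:C * w) * (cexp (- a%:C * L) - 1)) (cexp (b%:C * L) - 1).
by lra.
Unshelve. all: by end_near. Qed.

(** The difference [H] between [scaled n] and its limit is at most [k / 8] on a unit disc, so
    Cauchy's estimate gives it Lipschitz constant [k / 4]; the limit itself contributes the other
    [k / 4]. *)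
Lemma scaled_newton (d : R) :
  (forall z r, Q1 z -> 0 < r -> 3 * r < complex.Re z -> r < complex.Im z ->
     poly_approx psi z r) ->
  d <= 4^-1 ->
  (forall w1 w2, cmod w1 <= d -> cmod w2 <= d ->
     cmod (cexp (k%:C * w1) - cexp (k%:C * w2) - k%:C * (w1 - w2)) <=
       k / 4 * cmod (w1 - w2)) ->
  \forall n \near \oo, forall w1 w2, cmod w1 <= d -> cmod w2 <= d ->
     cmod (scaled n w1 - scaled n w2 + k%:C * (w1 - w2)) <= k / 2 * cmod (w1 - w2).
Proof.
move=> loc d4 hd; have k0 := k_gt0; have k8 : 0 < k / 8 by lra.
near=> n => w1 w2 w1d w2d.
have hs w : cmod w <= 2 -> cmod (scaled n w - (1 - cexp (k%:C * w))) <= k / 8.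
  by move: w; near: n; exact: scaled_near.
(* [loc] on a disc of radius 1 requires a real part above 3. *)
have [_ _ h1 h2] : [/\ `|complex.Re (predicted n + w1)| <= 1 * t n,
    `|complex.Im (predicted n + w1) - t n| <= 1 * t n,
    4 <= complex.Re (predicted n + w1) & 4 <= complex.Im (predicted n + w1)].
  have : cmod w1 <= 2 by lra.
  by move: w1 {w1d}; near: n; exact: predicted_near.
pose H w := scaled n w + (-1) * (1 - cexp (k%:C * w)).
have Happ : poly_approx H w1 1.
  apply: poly_approxD; last first.
    apply: poly_approxZ; apply: poly_approxD; first exact: poly_approx_cst.
    have -> : (fun w => - cexp (k%:C * w)) = (fun w => (-1) * cexp (k%:C * w)).
      by apply/funext => w; rewrite mulN1r.
    by apply: poly_approxZ; exact: poly_approx_cexp.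
  have -> : scaled n = (fun w => (scaling n)^-1 * (psi (predicted n + w) + - q%:C)).
    by apply/funext => w; rewrite /scaled mulrC.
  apply: poly_approxZ; apply: poly_approxD; last exact: poly_approx_cst.
  have P : poly_approx psi (predicted n + w1) 1.
    by apply: loc => //; [split; lra|lra|lra].
  by move=> e /P[p hp]; exists p => w /hp; rewrite addrA.
have HS w : cmod w <= 1 -> cmod (H (w1 + w)) <= k / 8.
  move=> w1'; rewrite /H mulN1r; apply: hs.
  by rewrite (le_trans (ler_cmodD _ _)) //; lra.
have w12 : cmod (w2 - w1) <= 1 / 2 by rewrite (le_trans (ler_cmodB _ _)) //; lra.
have := poly_approx_lipschitz ltr01 Happ HS w12.
rewrite subrKC divr1 => HL; have := hd w1 w2 w1d w2d.
have -> : scaled n w1 - scaled n w2 + k%:C * (w1 - w2) =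
  - (cexp (k%:C * w1) - cexp (k%:C * w2) - k%:C * (w1 - w2)) - (H w2 - H w1).
  by rewrite /H; ring.
move=> h3; rewrite (le_trans (ler_cmodB _ _)) // cmodN.
by rewrite cmodC in HL; rewrite [X in _ + X]cmodC; rewrite (cmodC w2) in HL; lra.
Unshelve. all: by end_near. Qed.

(* Taking logarithms in [A exp (k z) z^-a = - B z^b (1 + o(1))]. *)
Lemma zeros_log e : 0 < e -> \forall z \near @Q1_infty R, psi z = q%:C ->
  exists n : int, cmod (k%:C * z - (a + b)%:C * clog z - clog (B / A) - 0 +i* pi
    - 0 +i* (2 * pi * n%:~R)) <= e.
Proof.
move=> e0; have b0 := b_gt0.
have B0 : 0 < cmod B by rewrite cmod_gt0.
pose c := cmod (B / A); have c0 : 0 <= c := cmod_ge0 _.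
have [de de0 hde] := cexp_near1 e0.
pose m := Num.min 1 de; have m0 : 0 < m by rewrite lt_min ltr01.
have [m1 mde] : m <= 1 /\ m <= de by rewrite !ge_min !lexx orbT.
have c2 : 0 < 2 * (c + 2) by lra.
(* For [y = cmod (cexp v - 1)] the asymptotics give [cmod B * y <= e1 * (c * (1 + y) + 2)], with [y]
   on both sides since [X] is not yet compared with [Y]. This [e1] turns it into
   [2 * (c + 2) * y <= m * (c * (1 + y) + 2)], and [m <= 1] absorbs the right-hand [y], leaving
   [y <= m]. *)
pose e1 := cmod B * (m / (2 * (c + 2))).
have e10 : 0 < e1 by rewrite mulr_gt0 // divr_gt0.
near=> z => zq.
have hA : cmod (psi z - (A * cexp (k%:C * z) * cpow z (- a)%:C + B * cpow z b%:C)) <=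
  e1 * (cmod (cexp (k%:C * z) * cpow z (- a)%:C) + cmod (cpow z b%:C)).
  by near: z; exact: asym.
have hq : `|q| / e1 <= expR (b * ln (cmod z)).
  near: z; apply: (near_cmod (Q := fun t => _ <= expR (b * ln t))).
  exact: expR_ln_ge_near.
pose v := k%:C * z - (a + b)%:C * clog z - clog (B / A) - 0 +i* pi.
move: hA; set X := cexp (k%:C * z) * _; set Y := cpow z b%:C => hA.
have Y0 : Y != 0 := cexp_neq0 _.
have cY : cmod Y = expR (b * ln (cmod z)) by rewrite /Y cpowE cmod_cexp cReZ.
have Yp : 0 < cmod Y by rewrite cmod_gt0.
have XE : X = - (B / A) * cexp v * Y.
  have -> : - (B / A) * cexp v * Y = cexp (clog (B / A)) * cexp (0 +i* pi) * cexp v * Y.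
    by rewrite clogK // cexp_pi; ring.
  rewrite /X /Y !cpowE -!cexpD; congr cexp.
  by rewrite /v rmorphD rmorphN /=; ring.
have v1 : cmod (cexp v - 1) <= de.
  set y := cmod (cexp v - 1).
  have vy : cmod (cexp v) <= 1 + y.
    by have := ler_cmod_dist (cexp v) 1; rewrite cmod1 /y; lra.
  have h1 : cmod B * y * cmod Y <= e1 * (c * (1 + y) + 2) * cmod Y.
    have -> : cmod B * y * cmod Y = cmod (psi z - q%:C - (psi z - (A * X + B * Y)) + q%:C).
      rewrite -cmodM -cmodM -cmodN; congr cmod; rewrite XE.
      by field; exact: A_neq0.
    rewrite zq subrr sub0r (le_trans (ler_cmodD _ _)) // cmodN -zq /X mulrA -/X.
    have cX : cmod X <= c * (1 + y) * cmod Y.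
      rewrite XE cmodM cmodM cmodN -/c ler_wpM2r ?cmod_ge0 //.
      by rewrite ler_wpM2l.
    have hq' : cmod (psi z) <= e1 * cmod Y.
      by rewrite zq cmod_real cY mulrC -ler_pdivrMr.
    have : e1 * cmod X <= e1 * (c * (1 + y) * cmod Y) by rewrite ler_wpM2l // ltW.
    by lra.
  have h2 : y <= m / (2 * (c + 2)) * (c * (1 + y) + 2).
    by rewrite -(ler_pM2l B0) -(ler_pM2r Yp) (le_trans h1) // /e1 !mulrA.
  have y0 : 0 <= y := cmod_ge0 _.
  move: h2; rewrite mulrAC ler_pdivlMr // => h2.
  have : m * (c * y) <= c * y by rewrite ler_piMl // mulr_ge0.
  by nra.
exact: hde v v1.
Unshelve. all: by end_near. Qed.

(** A bootstrap: with error at most 1, the relation of [zeros_log] already shows that [Re z] is of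
    order [ln (cmod z)] and that [Im z] is within a constant of a grid point. So [z] is close to
    vertical, [clog z] may be replaced by [lam n], and the relation becomes the equation of
    [predicted n]. *)
Lemma zeros_near_predicted e N : 0 < e -> \forall z \near @Q1_infty R,
  psi z = q%:C -> exists2 n, (N <= n)%N & cmod (z - predicted n) <= e.
Proof.
move=> e0; have k0 := k_gt0; have a0 := a_ge0; have b0 := b_gt0.
have s0 : 0 < a + b by lra.
pose e2 := Num.min 1 (k * e / 2).
have e20 : 0 < e2 by rewrite lt_min ltr01 divr_gt0 ?mulr_gt0.
have [e21 e2e] : e2 <= 1 /\ e2 <= k * e / 2 by rewrite !ge_min !lexx orbT.
have e30 : 0 < k * e / 2 / (a + b) by rewrite !divr_gt0 ?mulr_gt0.
have [eta eta0 heta] := clog_near e30.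
(* [1 / 4] yields [cmod z / 2 <= tt], after which [eta / 2] converts errors relative to [cmod z]
   into errors relative to [tt]. *)
pose mu := Num.min (1 / 4) (eta / 2).
have mu0 : 0 < mu by rewrite lt_min !divr_gt0.
have [mu4 mue] : mu <= 1 / 4 /\ mu <= eta / 2 by rewrite !ge_min !lexx orbT.
have kmu : 0 < k * mu by rewrite mulr_gt0.
near=> z => zq.
have [n hn] : exists n : int, cmod (k%:C * z - (a + b)%:C * clog z - clog (B / A) - 0 +i* pi
    - 0 +i* (2 * pi * n%:~R)) <= e2 by move: zq; near: z; exact: zeros_log.
have Qz : Q1 z by near: z; exact: near_Q1.
have z1 : 1 <= cmod z.
  near: z; apply: (near_cmod (Q := fun t => 1 <= t)); apply: nbhs_pinfty_ge; exact: num_real.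
have z0 : z != 0 by rewrite -cmod_gt0; lra.
have hRe : 1 + `|ln (cmod (B / A))| + (a + b) * ln (cmod z) <= k * mu * cmod z.
  near: z; apply: (near_cmod (Q := fun t => _ + _ * ln t <= _ * t)).
  exact: ln_le_linear.
have hIm : (1 + (a + b) * pi + `|carg (B / A)| + pi) + 0 * ln (cmod z) <= k * mu * cmod z.
  near: z; apply: (near_cmod (Q := fun t => _ + _ * ln t <= _ * t)).
  exact: ln_le_linear.
(* Together with [cmod z / 2 <= tt] this gives [N <= n], which also shows that the integer [n] is a
   natural number. *)
have hN : 2 * (2 * N%:R * pi / k) <= cmod z.
  near: z; apply: (near_cmod (Q := fun t => _ <= t)); apply: nbhs_pinfty_ge; exact: num_real.
pose v := k%:C * z - (a + b)%:C * clog z - clog (B / A) - 0 +i* pi.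
rewrite -/v in hn; pose tt := 2 * n%:~R * pi / k : R.
have ln0 : 0 <= ln (cmod z) by exact: ln_ge0.
have [Re0 Im0] := Qz.
have bRe : `|complex.Re z| <= mu * cmod z.
  have := le_trans (le_trans (ler_Re _) hn) e21.
  rewrite /v !(cReD, cReN, cReZ) /= => /ler_normlP[h1 h2].
  rewrite gtr0_norm // -(ler_pM2l k0) mulrA; have := ler_norm (ln (cmod (B / A))); lra.
have bIm : `|complex.Im z - tt| <= mu * cmod z.
  have := le_trans (le_trans (ler_Im _) hn) e21.
  rewrite /v !(cImD, cImN, cImZ) /= => /ler_normlP[h1 h2].
  have /ler_normlP[g1 g2] := carg_le_pi z0.
  have : (a + b) * carg z <= (a + b) * pi by rewrite ler_wpM2l // ltW.
  have : (a + b) * - carg z <= (a + b) * pi by rewrite ler_wpM2l // ltW.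
  have : - `|carg (B / A)| <= carg (B / A) <= `|carg (B / A)|.
    by rewrite lerNnormlW // ler_norm.
  move=> f1 f2 f3; have pi0 := pi_gt0 R.
  have kt : k * (complex.Im z - tt) = k * complex.Im z - 2 * pi * n%:~R.
    by rewrite /tt; field; rewrite gt_eqF.
  rewrite -(ler_pM2l k0).
  have -> : k * `|complex.Im z - tt| = `|k * (complex.Im z - tt)| by rewrite normrM gtr0_norm.
  rewrite kt ler_norml.
  lra.
have zle : cmod z <= complex.Re z + complex.Im z.
  by rewrite (le_trans (cmod_le_ReIm z)) // !gtr0_norm.
have muz : mu * cmod z <= 1 / 4 * cmod z by rewrite ler_wpM2r ?cmod_ge0.
have tz : cmod z / 2 <= tt.
  move: bRe bIm => /ler_normlP[_ h1] /ler_normlP[_ h2]; lra.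
have tt0 : 0 < tt by lra.
have mut : mu * cmod z <= eta * tt.
  have : eta / 2 * cmod z <= eta / 2 * (2 * tt).
    by rewrite ler_wpM2l ?divr_ge0 ?(ltW eta0) //; lra.
  have : mu * cmod z <= eta / 2 * cmod z by rewrite ler_wpM2r ?cmod_ge0.
  by lra.
have pk : 0 < 2 * pi / k :> R by rewrite divr_gt0 ?mulr_gt0 ?pi_gt0.
have Nn : N%:R <= n%:~R :> R.
  rewrite -(ler_pM2r pk); have : tt = n%:~R * (2 * pi / k) by rewrite /tt; ring.
  have : 2 * N%:R * pi / k = N%:R * (2 * pi / k) by ring.
  by lra.
move: Nn; rewrite -[N%:R]/(N%:Z%:~R) ler_int => Nn.
have [n' n'E] : exists n' : nat, n = n'%:Z by case: (n) Nn => // n' _; exists n'.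
move: Nn hn; rewrite n'E lez_nat => Nn hn; exists n' => //.
have tE : tt = t n' by rewrite /tt n'E.
have hL : cmod (clog z - lam n') <= k * e / 2 / (a + b).
  rewrite /lam -tE; apply: heta => //; first exact: le_trans mut.
  exact: le_trans mut.
have kE : k%:C * (z - predicted n') =
  (v - 0 +i* (2 * pi * (n'%:Z)%:~R)) + (a + b)%:C * (clog z - lam n').
  rewrite mulrBr k_predicted /v.
  have -> : 0 +i* ((2 * n'%:R + 1) * pi) = 0 +i* (2 * pi * (n'%:Z)%:~R) + 0 +i* pi :> R[i].
    by apply: complex_eqP; rewrite !(cReD, cImD) /= ?addr0 // -pmulrn; ring.
  by ring.
rewrite -(ler_pM2l k0) -{1}(gtr0_norm k0) -cmod_real -cmodM kE.
rewrite (le_trans (ler_cmodD _ _)) // cmodM cmod_real gtr0_norm //.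
have : (a + b) * cmod (clog z - lam n') <= k * e / 2 by rewrite mulrC -ler_pdivlMr.
by lra.
Unshelve. all: by end_near. Qed.

End Asymptotics.

(** * Simplicity of zeros, their order by modulus, and the conclusion *)

Section Conclusion.
Context {R : realType}.
Implicit Types (z w : R[i]).

Lemma complex_gt0_real (e : R[i]) : 0 < e -> exists2 x : R, 0 < x & e = x%:C.
Proof.
case: e => x y; rewrite ltcE /= => /andP[/eqP -> x0].
by exists x.
Qed.

Lemma quad_derivable_derive1 (F : R[i] -> R[i]) z (r K : R) (c : R[i]) : 0 < r ->
  (forall w, cmod w <= r -> cmod (F (z + w) - F z - c * w) <= K * cmod w ^+ 2) ->
  derive1 (F : R[i]^o -> R[i]^o) z = c.
Proof.
move=> r0 hF; apply: (@cvg_lim R[i]^o); first exact: norm_hausdorff.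
apply/cvgrPdist_le => _ /complex_gt0_real[e er0 ->].
pose dl := Num.min r (e / (`|K| + 1)).
have dl0 : 0 < dl by rewrite lt_min r0 divr_gt0 // ltr_wpDl.
have dlC : 0 < dl%:C :> R[i] by rewrite ltcR.
near=> h.
have h0 : h != 0 by near: h; exact: nbhs_dnbhs_neq.
have hd : cmod h <= dl.
  have : `|h : R[i]^o| < dl%:C by near: h; exact: dnbhs0_lt.
  by rewrite normc_cmod ltcR => /ltW.
have hr : cmod h <= r by rewrite (le_trans hd) // ge_min lexx.
rewrite normc_cmod lecR.
have -> : c - h^-1 *: (F (h + z) - F z) = - (h^-1 * (F (z + h) - F z - c * h)).
  by rewrite /GRing.scale /= (addrC h); field.
have hp : 0 < cmod h by rewrite cmod_gt0.
rewrite cmodN cmodM cmodV ler_pdivrMl // (le_trans (hF h hr)) //.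
rewrite expr2 mulrCA ler_wpM2l ?cmod_ge0 //.
apply: (@le_trans _ _ ((`|K| + 1) * dl)).
  apply: (@le_trans _ _ ((`|K| + 1) * cmod h)).
    by rewrite ler_wpM2r ?(ltW hp) // (le_trans (ler_norm K)) // lerDl.
  by rewrite ler_wpM2l // addr_ge0.
by rewrite mulrC -ler_pdivlMr ?ltr_wpDl // ge_min lexx orbT.
Unshelve. all: by end_near. Qed.

(** If the derivative vanished, the increment would be at most quadratic, against the linear lower
    bound; [s] is small enough for the two to conflict. *)
Lemma zero_order_one (F : R[i] -> R[i]) z (q : R[i]) (r ka rho : R) : 0 < r ->
  quad_derivable F z r -> F z = q -> 0 < ka -> 0 < rho ->
  (forall w, cmod w <= rho -> ka * cmod w <= cmod (F (z + w) - F z)) ->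
  zero_order (fun w => F w - q) z 1.
Proof.
move=> r0 [c [K hc]] Fq ka0 rho0 hF.
have hc' w : cmod w <= r ->
    cmod ((F (z + w) - q) - (F z - q) - c * w) <= K * cmod w ^+ 2.
  by move=> /hc; rewrite opprB addrA subrK.
split; first by case=> // _; rewrite derive1n0 Fq subrr.
rewrite derive1n1 (quad_derivable_derive1 r0 hc') => c0.
pose s := Num.min (Num.min r rho) (ka / (2 * (`|K| + 1))).
have K1 : 0 < `|K| + 1 by rewrite ltr_wpDl.
have s0 : 0 < s by rewrite !lt_min r0 rho0 divr_gt0 // mulr_gt0.
have sC : cmod s%:C = s by rewrite cmod_real gtr0_norm.
have [h1 h2 h3] : [/\ s <= r, s <= rho & s <= ka / (2 * (`|K| + 1))].
  by rewrite /s !ge_min !lexx !orbT.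
have := hc s%:C; have := hF s%:C; rewrite sC c0 mul0r subr0 => /(_ h2) g1 /(_ h1) g2.
have := le_trans g1 g2; rewrite expr2 mulrA ler_pM2r // => g3.
move: h3; rewrite ler_pdivlMr ?mulr_gt0 // => h3.
have : K * s <= `|K| * s by rewrite ler_wpM2r ?ler_norm // ltW.
by lra.
Qed.

(** Compare squared moduli, factoring each difference of squares: where the imaginary part
    dominates, a vertical gain of [3 / 2 * D] outweighs a horizontal loss of [1 / 2 * D]. *)
Lemma ltr_cmod z z' (D : R) : 0 < D ->
  0 < complex.Re z <= complex.Im z -> 0 < complex.Re z' <= complex.Im z' ->
  3 / 2 * D <= complex.Im z' - complex.Im z ->
  - (1 / 2 * D) <= complex.Re z' - complex.Re z -> cmod z < cmod z'.
Proof.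
move=> D0; rewrite -(@ltr_pXn2r _ 2 _ (cmod z)) ?nnegrE ?cmod_ge0 // !cmodE.
case: z z' => x y [x' y'] /= /andP[x0 xy] /andP[x0' xy'] dI dR.
have : 3 / 2 * D * (y' + y) <= (y' - y) * (y' + y) by rewrite ler_wpM2r //; lra.
have : - (1 / 2 * D) * (x' + x) <= (x' - x) * (x' + x) by rewrite ler_wpM2r //; lra.
have : D * (x' + x) <= D * (y' + y) by rewrite ler_wpM2l ?(ltW D0) //; lra.
have : 0 < D * (y' + y) by rewrite mulr_gt0 //; lra.
by rewrite !expr2; lra.
Qed.

Lemma card_one_unique (A : set nat) : (A #= `I_1)%card ->
  exists x, A = [set x].
Proof.
move=> /card_esym/card_set_bijP[f [fA injf surjf]]; exists (f 0%N).
apply/seteqP; split => [y /surjf[n /= ]|y ->].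
  by rewrite ltnS leqn0 => /eqP -> <-.
exact: fA.
Qed.

(* Distinct sufficiently large solutions have distinct moduli and are listed once,
   so from some index on the list runs through them in order. *)
Lemma enumeration_tail (zeta W : nat -> R[i]) (S : set R[i]) (M : R) (N : nat) :
  (forall n, (0 < n)%N -> S (zeta n)) ->
  (forall n, (0 < n)%N -> cmod (zeta n) <= cmod (zeta n.+1)) ->
  (forall n, (N <= n)%N -> exists2 j, (0 < j)%N &
     forall j', ((0 < j')%N /\ zeta j' = W n) <-> j' = j) ->
  (forall n, (N <= n)%N -> cmod (W n) < cmod (W n.+1)) ->
  (forall z, S z -> M < cmod z -> exists2 n, (N <= n)%N & z = W n) ->
  (exists2 n, (N <= n)%N & M < cmod (W n)) ->
  exists j0 n0 : nat, forall i, zeta (j0 + i)%N = W (n0 + i)%N.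
Proof.
move=> zS zmono uniq Winc Wall [n0 Nn0 MW].
have zle i j : (0 < i)%N -> (i <= j)%N -> cmod (zeta i) <= cmod (zeta j).
  move=> i0; elim: j => [|j IH]; first by rewrite leqn0 => /eqP E; rewrite E in i0.
  rewrite leq_eqVlt => /orP[/eqP -> //|]; rewrite ltnS => ij.
  by rewrite (le_trans (IH ij)) // zmono // (leq_trans i0).
have Wlt n m : (N <= n)%N -> (n < m)%N -> cmod (W n) < cmod (W m).
  move=> Nn; elim: m => // m IH; rewrite ltnS leq_eqVlt => /orP[/eqP <-|nm].
    exact: Winc.
  by apply: lt_trans (IH nm) _; apply: Winc; lia.
have Wle n m : (N <= n)%N -> cmod (W n) <= cmod (W m) -> (N <= m)%N -> (n <= m)%N.
  move=> _ nm Nm; rewrite leqNgt; apply/negP => /(Wlt _ _ Nm).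
  by rewrite ltNge nm.
have [j0 j00 hj0] := uniq n0 Nn0.
exists j0, n0; elim=> [|i IH]; first by rewrite !addn0; have [_ /(_ erefl)[]] := hj0 j0.
set j := (j0 + i)%N in IH; set n := (n0 + i)%N in IH.
rewrite !addnS -/j -/n.
have Nn : (N <= n)%N by rewrite /n; lia.
have j_gt0 : (0 < j)%N by rewrite /j; lia.
have MWn : M < cmod (W n).
  apply: (lt_le_trans MW); case: (ltngtP n0 n) => [/Wlt h|h|<- //]; first exact/ltW/h.
  by rewrite /n in h; lia.
have zj : cmod (zeta j) <= cmod (zeta j.+1) by exact: zmono.
have [n' Nn' zn'] : exists2 n', (N <= n')%N & zeta j.+1 = W n'.
  apply: Wall; first exact: zS.
  by rewrite (lt_le_trans MWn) // -IH.
have nn' : (n <= n')%N by apply: Wle => //; rewrite -zn' -IH.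
(* Equality would list [W n] twice, at [j] and at [j + 1]. *)
have n'n : n' != n.
  apply/eqP => E; have [jn _ h] := uniq n Nn.
  have e1 := (h j).1 (conj j_gt0 IH).
  have e2 : j.+1 = jn by apply/(h j.+1).1; split => //; rewrite zn' E.
  by lia.
have n1n' : (n.+1 <= n')%N by rewrite ltn_neqAle eq_sym n'n.
(* If [n'] skipped [n + 1], the place [js] of [W n.+1] in the list would lie strictly between [j]
   and [j + 1]. *)
have [js js0 hs] := uniq n.+1 ltac:(lia).
have [_ zjs] := (hs js).2 erefl.
have [E|lt1] : n' = n.+1 \/ (n.+1 < n')%N by lia.
  by rewrite zn' E.
have j1 : (j < js)%N.
  rewrite ltnNge; apply/negP => /(zle _ _ js0); rewrite zjs IH leNgt.
  by rewrite Wlt //.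
have j2 : (js < j.+1)%N.
  rewrite ltnNge; apply/negP => /(zle _ _ (ltn0Sn j)); rewrite zjs zn' leNgt.
  by rewrite Wlt //; lia.
by lia.
Qed.
End Conclusion.

Theorem theorem2 (R : realType) (d : measure_display) (T : measurableType d)
    (P : probability T R) (X : R -> {RV P >-> R})
    (Pi : {measure set (measurableTypeR R) -> \bar R}) (psi : R[i] -> R[i])
    (k q : R) (zeta : nat -> R[i]) (A B : R[i]) (a b : R)
    (X_levy : levy_process X)
    (k_def : k%:E = ereal_inf
       [set x%:E | x in [set x : R | 0 < x /\ Pi `]x, +oo[%classic = 0%E]])
    (k_gt0 : 0 < k)
    (psi_exponent : laplace_exponent X Pi k psi)
    (q_gt0 : 0 < q)
    (zeta_solutions : lists_solutions Q1 psi q%:C zeta)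
    (A_neq0 : A <> 0) (B_neq0 : B <> 0) (a_ge0 : 0 <= a) (b_gt0 : 0 < b)
    (psi_asymptotics :
       exists r1 r2 : R[i] -> R[i]^o,
       [/\ r1 =o_Q1_infty
               (fun z => cexp (k%:C * z) * cpow z (- a)%:C : R[i]^o),
           r2 =o_Q1_infty (fun z => cpow z b%:C : R[i]^o) &
           forall z, Q1 z ->
             psi z = A * cexp (k%:C * z) * cpow z (- a)%:C + B * cpow z b%:C
                   + r1 z + r2 z]) :
  (exists M : R, forall z, Q1 z -> psi z = q%:C -> M < cmod z ->
     zero_order (fun w => psi w - q%:C) z 1) /\
  (exists m : int,
     (fun n : nat =>
        zeta `|(n%:Z + m)%R|%N
        - ((k^-1 * (ln (cmod (B / A)) + (a + b) * ln (2 * n%:R * pi / k))) +i*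
           (k^-1 * (carg (B / A) + (2^-1 * (a + b) + 2 * n%:R + 1) * pi)))
        : R[i]^o) @ \oo --> (0 : R[i]^o)).
Proof.
have A0 : A != 0 by exact/eqP.
have B0 : B != 0 by exact/eqP.
have k0 := k_gt0; have s0 : 0 < a + b by lra.
have loc := laplace_exponent_local k_gt0 psi_exponent.
have asym (e : R) : 0 < e -> \forall z \near @Q1_infty R,
    cmod (psi z - (A * cexp (k%:C * z) * cpow z (- a)%:C + B * cpow z b%:C)) <=
    e * (cmod (cexp (k%:C * z) * cpow z (- a)%:C) + cmod (cpow z b%:C)).
  move=> e0; have eC : 0 < e%:C :> R[i] by rewrite ltcR.
  have [r1 [r2 [/eqoP/(_ _ eC) o1 /eqoP/(_ _ eC) o2 psiE]]] := psi_asymptotics.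
  near=> z.
  have Qz : Q1 z by near: z; exact: near_Q1.
  have h1 : cmod (r1 z) <= e * cmod (cexp (k%:C * z) * cpow z (- a)%:C).
    by rewrite -lecR rmorphM /= -!normc_cmod; near: z; exact: o1.
  have h2 : cmod (r2 z) <= e * cmod (cpow z b%:C).
    by rewrite -lecR rmorphM /= -!normc_cmod; near: z; exact: o2.
  rewrite psiE // -[X in cmod (X - _)]addrA addrAC subrr add0r.
  by rewrite (le_trans (ler_cmodD _ _)) // mulrDr lerD.
pose p := predicted k a b A B; pose G := scaled k a b q A B psi.
have Gsol n w : G n w = 0 <-> psi (p n + w) = q%:C.
  split=> [/eqP|E]; last by rewrite /G /scaled -/p E subrr mul0r.
  rewrite mulf_eq0 invr_eq0 (negPf (scaling_neq0 k b B0 n)) orbF subr_eq0.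
  by move/eqP.
have [dl /andP[d0 d4] hd] := cexp_lipschitz k_gt0.
pose newton n := forall w1 w2, cmod w1 <= dl -> cmod w2 <= dl ->
  cmod (G n w1 - G n w2 + k%:C * (w1 - w2)) <= k / 2 * cmod (w1 - w2).
have near_newton : \forall n \near \oo, newton n.
  by apply: scaled_newton => // z r Qz r0 h1 h2; have [] := loc z r Qz r0 h1 h2.
have near_sol e : 0 < e -> e <= dl -> \forall n \near \oo,
    exists w, cmod w <= e /\ psi (p n + w) = q%:C.
  move=> e0 ed; have ke : 0 < k * e / 2 by rewrite divr_gt0 ?mulr_gt0.
  near=> n.
  have Nn : newton n by near: n.
  have [||w [we /Gsol wG]] := @newton_zero _ (G n) k e k0 e0; last by exists w.
  - by move=> w1 w2 h1 h2; apply: Nn; [exact: le_trans h1 ed|exact: le_trans h2 ed].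
  (* At [w = 0] the limit [1 - exp (k w)] vanishes, so the initial residual is as small as
     desired. *)
  - have : forall w, cmod w <= 2 -> cmod (G n w - (1 - cexp (k%:C * w))) <= k * e / 2.
      by near: n; exact: scaled_near.
    by move=> /(_ 0); rewrite cmod0 mulr0 cexp0 subrr subr0; apply.
have uniq_sol n w1 w2 : newton n -> cmod w1 <= dl -> cmod w2 <= dl ->
    psi (p n + w1) = q%:C -> psi (p n + w2) = q%:C -> w1 = w2.
  move=> Nn h1 h2 /Gsol g1 /Gsol g2; have := Nn w1 w2 h1 h2.
  rewrite g1 g2 subrr add0r cmodM cmod_real gtr0_norm // => h3.
  apply/eqP; rewrite -subr_eq0 -cmod_eq0 eq_le cmod_ge0 andbT.
  by rewrite -(ler_pM2l k0) mulr0; have := cmod_ge0 (w1 - w2); nra.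
(* Uniqueness holds at radius [dl], but the choice is made at [dl / 2]: a further displacement by
   [dl / 2] then stays in the Newton disc, as needed for simplicity. *)
pose c n := xget 0 [set w | cmod w <= dl / 2 /\ psi (p n + w) = q%:C].
pose W n := p n + c n.
have d20 : 0 < dl / 2 by lra.
have near_c : \forall n \near \oo, cmod (c n) <= dl / 2 /\ psi (W n) = q%:C.
  near=> n; have [w hw] : exists w, cmod w <= dl / 2 /\ psi (p n + w) = q%:C.
    by near: n; apply: near_sol => //; lra.
  exact: (xgetPex 0 (ex_intro [set w | cmod w <= dl / 2 /\ psi (p n + w) = q%:C] w hw)).
(* The zero found within [e] of [p n] must be the chosen one, by uniqueness. *)
have c_small e : 0 < e -> \forall n \near \oo, cmod (c n) <= e.
  move=> e0; pose e' := Num.min e dl; have e'0 : 0 < e' by rewrite lt_min e0.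
  have [e'e e'dl] : e' <= e /\ e' <= dl by rewrite !ge_min !lexx orbT.
  near=> n; have [w [we wq]] : exists w, cmod w <= e' /\ psi (p n + w) = q%:C.
    by near: n; exact: near_sol.
  have [cd cq] : cmod (c n) <= dl / 2 /\ psi (W n) = q%:C by near: n.
  have Nn : newton n by near: n.
  have -> : c n = w by apply: (uniq_sol n) => //; lra.
  exact: le_trans we e'e.
(* Displacing two consecutive points by at most [pi / k / 4] each leaves, of the vertical step
   [2 * (pi / k)], at least the [3 / 2], and horizontally at most the [1 / 2], required by
   [ltr_cmod] with [D = pi / k]. *)
have kd0 : 0 < pi / k / 4 :> R by rewrite !divr_gt0 ?pi_gt0.
pose t n : R := 2 * n%:R * pi / k.
have [N0 _ HN0] : \forall n \near \oo, [/\ newton n,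
    cmod (c n) <= dl / 2 /\ psi (W n) = q%:C,
    cmod (c n) <= pi / k / 4, (0 < n)%N &
    [/\ `|complex.Re (W n)| <= 1 / 4 * t n, `|complex.Im (W n) - t n| <= 1 / 4 * t n,
      1 <= complex.Re (W n) & 1 <= complex.Im (W n)]].
  near=> n.
  have h1 : newton n by near: n.
  have h2 : cmod (c n) <= dl / 2 /\ psi (W n) = q%:C by near: n.
  have h3 : cmod (c n) <= pi / k / 4 by near: n; exact: c_small.
  have h4 : (0 < n)%N by near: n; exact: nbhs_infty_gt.
  split => //.
  have : cmod (c n) <= 2 by lra.
  rewrite /W; move: (c n); near: n; apply: predicted_near => //; lra.
have [M1 HM1] := zeros_near_predicted q k_gt0 a_ge0 b_gt0 A0 B0 asym N0 d20.
have all_large z : Q1 z -> psi z = q%:C -> M1 < cmod z ->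
    exists n w, [/\ (N0 <= n)%N, z = p n + w & cmod w <= dl / 2].
  move=> Qz zq zM; have [n Nn h] := HM1 z Qz zM zq.
  by exists n, (z - p n); split; rewrite ?subrKC.
have simple n w : (N0 <= n)%N -> cmod w <= dl / 2 -> psi (p n + w) = q%:C ->
    zero_order (fun z => psi z - q%:C) (p n + w) 1.
  move=> Nn wd wq; have [Nw [cd cq] _ _ [_ _ Re1 Im1]] := HN0 n Nn.
  have wc : w = c n by apply: (uniq_sol n) => //; lra.
  rewrite wc -/(W n).
  pose r : R := 1 / 4.
  have [_ QD] : poly_approx psi (W n) r /\ quad_derivable psi (W n) r.
    by apply: loc; [split; lra|rewrite /r; lra..].
  have sc0 : 0 < cmod (scaling k b B n) by rewrite cmod_gt0 scaling_neq0.
  (* The Newton estimate read backwards: an increment of [G n] is at least [k - k / 2] times that of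
     its argument, and undoing the normalisation multiplies by the modulus of [scaling]. *)
  apply: (zero_order_one _ QD cq (ka := cmod (scaling k b B n) * (k / 2)) _ d20).
  - by rewrite /r; lra.
  - by rewrite mulr_gt0 // divr_gt0.
  - move=> v vd; have h1 : cmod (c n + v) <= dl by rewrite (le_trans (ler_cmodD _ _)) //; lra.
    have h2 : cmod (c n) <= dl by lra.
    have := Nw _ _ h1 h2; rewrite (_ : c n + v - c n = v); last by rewrite addrC addKr.
    have -> : G n (c n + v) - G n (c n) =
        (psi (W n + v) - psi (W n)) / scaling k b B n.
      by rewrite /G /scaled -/p -mulrBl addrA -/(W n); congr (_ / _); ring.
    set D := psi _ - _ => h3.
    have : cmod (k%:C * v) - cmod (D / scaling k b B n) <= k / 2 * cmod v.
      rewrite -(cmodN (D / _)) (le_trans (ler_cmod_dist _ _)) //.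
      by rewrite opprK addrC.
    rewrite cmodM cmod_real gtr0_norm // cmodM cmodV => h4.
    rewrite -mulrA mulrC -ler_pdivlMr //; lra.
have solW n : (N0 <= n)%N -> Q1 (W n) /\ psi (W n) = q%:C.
  by move=> /HN0[_ [_ h] _ _ [_ _ h1 h2]]; split=> //; split; lra.
have [zeta_sol zeta_mono zeta_card] := zeta_solutions.
split.
  exists M1 => z Qz zq zM; have [n [w [Nn zE wd]]] := all_large z Qz zq zM.
  by rewrite zE in zq *; exact: simple.
have [||||||j0 [n0 tail]] := @enumeration_tail _ zeta W [set z | Q1 z /\ psi z = q%:C] M1 N0.
- by move=> n /zeta_sol.
- exact: zeta_mono.
- move=> n Nn; have [QW qW] := solW n Nn; have [_ [cd _] _ _ _] := HN0 n Nn.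
  have [j jE] := card_one_unique (zeta_card _ _ QW (simple n (c n) Nn cd qW)).
  have mem i : ((0 < i)%N /\ zeta i = W n) <-> i = j.
    by rewrite -[_ /\ _]/([set i | (0 < i)%N /\ zeta i = W n] i) jE.
  by exists j => //; have [] := (mem j).2 erefl.
- move=> n Nn; have [_ _ c1 n_gt0 [r1 i1 r2 i2]] := HN0 n Nn.
  have [_ _ c2 _ [r3 i3 r4 i4]] := HN0 n.+1 (leqW Nn).
  have pk : 0 < pi / k :> R by rewrite divr_gt0 ?pi_gt0.
  have tS : t n.+1 = t n + 2 * (pi / k) by rewrite /t -(natr1 n); ring.
  have t0 : 0 < t n by rewrite /t divr_gt0 // !mulr_gt0 ?pi_gt0 // ltr0n.
  have Im_p : complex.Im (p n.+1) = complex.Im (p n) + 2 * (pi / k).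
    by rewrite /p /predicted /= -(natr1 n); ring.
  have Re_p : complex.Re (p n) <= complex.Re (p n.+1).
    rewrite /p /predicted /= ler_wpM2l ?invr_ge0 ?(ltW k0) // lerD2l ler_wpM2l ?(ltW s0) //.
    by rewrite -/(t n) -/(t n.+1) ler_ln ?posrE; lra.
  have /ler_normlP[a1 a2] := le_trans (ler_Re _) c1.
  have /ler_normlP[a3 a4] := le_trans (ler_Im _) c1.
  have /ler_normlP[b1 b2] := le_trans (ler_Re _) c2.
  have /ler_normlP[b3 b4] := le_trans (ler_Im _) c2.
  have dI : 3 / 2 * (pi / k) <= complex.Im (W n.+1) - complex.Im (W n).
    by rewrite !cImD Im_p; lra.
  have dR : - (1 / 2 * (pi / k)) <= complex.Re (W n.+1) - complex.Re (W n).
    by rewrite !cReD; lra.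
  have le1 : complex.Re (W n) <= complex.Im (W n).
    by move: r1 i1 => /ler_normlP[_ g1] /ler_normlP[g2 _]; lra.
  have le2 : complex.Re (W n.+1) <= complex.Im (W n.+1).
    by move: r3 i3 => /ler_normlP[_ g1] /ler_normlP[g2 _]; lra.
  apply: (ltr_cmod pk) => //; apply/andP; split => //; exact: lt_le_trans ltr01 _.
- move=> z [Qz zq] zM; have [n [w [Nn zE wd]]] := all_large z Qz zq zM.
  exists n => //; have [Nw [cd cq] _ _ _] := HN0 n Nn.
  rewrite zE; congr (_ + _); apply: (uniq_sol n) => //; [lra|lra|by rewrite -zE].
- have [N1 _ HN1] : \forall n \near \oo, forall w, cmod w <= 2 ->
    [/\ `|complex.Re (p n + w)| <= 1 * t n, `|complex.Im (p n + w) - t n| <= 1 * t n,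
      M1 + 1 <= complex.Re (p n + w) & M1 + 1 <= complex.Im (p n + w)].
    exact: predicted_near.
  exists (maxn N0 N1); first exact: leq_maxl.
  have [_ [cd _] _ _ _] := HN0 _ (leq_maxl N0 N1).
  have [|_ _ h _] := HN1 _ (leq_maxr N0 N1) (c (maxn N0 N1)); first by lra.
  have := ler_Re (W (maxn N0 N1)); rewrite ler_norml => /andP[_].
  by rewrite -/(W _) in h; lra.
(* The shift may be negative, but from [n = n0] on the index equals [j0 + (n - n0)] and the absolute
   value is harmless. *)
exists (j0%:Z - n0%:Z); apply/cvgrPdist_le => e' /complex_gt0_real[e er0 ->] {e'}.
have c_e := c_small e er0; near=> n.
have n0n : (n0 <= n)%N by near: n; exact: nbhs_infty_ge.
have -> : `|(n%:Z + (j0%:Z - n0%:Z))%R|%N = (j0 + (n - n0))%N by lia.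
rewrite tail subnKC // sub0r normrN normc_cmod lecR.
rewrite -[_ +i* _]/(p n) (_ : W n - p n = c n); last by rewrite /W addrC addKr.
by near: n.
Unshelve. all: by end_near. Qed.
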